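(* Let $I\subset S=K[x_1,\dots,x_n]$ be a homogeneous $\mathfrak m$-primary ideal generated in degree $d$. Suppose that either (i) $I$ is linearly presented, or (ii) $K$ is algebraically closed and $\mathfrak m^d\subset I+(z_3,\dots, z_n)$ for all sequences of $n-2$ independent linear forms $z_3,\dots, z_n$. Then $I^t=\mathfrak m^{dt}$ for all $t\gg 0$.
   Context: $K$ is a field, $S=K[x_1,\dots,x_n]$ is the polynomial ring graded with $\deg x_i=1$, and $\mathfrak m=(x_1,\dots,x_n)$. An ideal $I$ generated in degree $d$ is linearly presented if its minimal graded free presentation has the form $S^{n_1}(-d-1)\to S^{n_0}(-d)\to I\to 0$. *)

(* Defs.v *)
From mathcomp Require Import all_boot all_order all_algebra.
From mathcomp Require Import mpoly.

Set Implicit Arguments.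
Unset Strict Implicit.
Unset Printing Implicit Defensive.

Import GRing.Theory.
Local Open Scope ring_scope.

(* Ideals are Prop-valued predicates, compared up to pointwise equivalence:
   MathComp's [idealr_closed] is about boolean predicates and so only covers
   decidable ideals. *)
Section Ideals.
Variable R : comNzRingType.
Implicit Types I J G : R -> Prop.

Definition is_ideal I : Prop :=
  [/\ I 0, forall x y, I x -> I y -> I (x + y) & forall a x, I x -> I (a * x)].

Definition ideal_le I J : Prop := forall x, I x -> J x.

Definition ideal_eq I J : Prop := forall x, I x <-> J x.

Definition ideal_gen G : R -> Prop := fun x =>
  forall J, is_ideal J -> ideal_le G J -> J x.

Definition ideal_add I J : R -> Prop := fun x =>
  exists y z, [/\ I y, J z & x = y + z].

Definition ideal_mul I J : R -> Prop :=
  ideal_gen (fun x => exists y z, [/\ I y, J z & x = y * z]).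

Fixpoint ideal_pow I (t : nat) : R -> Prop :=
  if t is s.+1 then ideal_mul I (ideal_pow I s) else fun=> True.

Definition radical I : R -> Prop := fun x => exists k : nat, I (x ^+ k).

Definition primary I : Prop :=
  [/\ is_ideal I, ~ I 1 & forall x y, I (x * y) -> I x \/ radical I y].

End Ideals.

Section GradedIdeals.
Variables (n : nat) (K : fieldType).
Local Notation S := {mpoly K[n]}.
Implicit Type I : S -> Prop.

Definition maxid : S -> Prop := ideal_gen (fun p => exists i : 'I_n, p = 'X_i).

Definition maxid_primary I : Prop := primary I /\ ideal_eq (radical I) maxid.

Definition homogeneous_ideal I : Prop :=
  forall p, I p -> forall k, I (pihomog mdeg k p).

Definition generated_in_degree (d : nat) I : Prop :=
  ideal_eq I (ideal_gen (fun p => I p /\ p \is d.-homog)).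

(* p, seen in S(-a), is homogeneous of degree b: p has degree b - a, and is 0
   when that difference is negative. *)
Definition shifted_homog (a b : nat) (p : S) : bool :=
  if (a <= b)%N then p \is (b - a).-homog else p == 0.

(* A minimal graded free presentation
     (+)_j S(-b j) --phi--> (+)_i S(-a i) --f--> I --> 0.
   Free modules consist of row vectors, and maps act by right multiplication.
   The first two clauses say that phi and f are homogeneous of degree 0, the
   next two are exactness, and the last two are minimality: the kernel of each
   map is contained in the maximal ideal times its source. *)
Definition minimal_graded_presentation I (n1 n0 : nat)
    (b : 'I_n1 -> nat) (a : 'I_n0 -> nat)
    (phi : 'M[S]_(n1, n0)) (f : 'cV[S]_n0) : Prop :=
  [/\ forall j i, shifted_homog (a i) (b j) (phi j i),
      forall i, f i 0 \is (a i).-homog,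
      forall p, I p <-> exists u : 'rV[S]_n0, p = (u *m f) 0 0,
      forall u : 'rV[S]_n0,
        u *m f = 0 <-> exists v : 'rV[S]_n1, u = v *m phi &
      (forall u : 'rV[S]_n0, u *m f = 0 -> forall i, maxid (u 0 i)) /\
      (forall v : 'rV[S]_n1, v *m phi = 0 -> forall j, maxid (v 0 j))].

(* Minimal graded free presentations are unique up to isomorphism, so one of
   the required shape is the same as all of them being so. *)
Definition linearly_presented (d : nat) I : Prop :=
  exists n1 n0 : nat, exists (phi : 'M[S]_(n1, n0)) (f : 'cV[S]_n0),
    minimal_graded_presentation I (fun=> d.+1) (fun=> d) phi f.

Definition independent_linear_forms (k : nat) (z : 'I_k -> S) : Prop :=
  (forall j, z j \is 1.-homog) /\
  (forall c : 'I_k -> K, \sum_j c j *: z j = 0 -> forall j, c j = 0).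

End GradedIdeals.

Arguments maxid {n K}.

(* Main.v *)
Require Import Defs.
From HB Require Import structures.
From mathcomp Require Import all_boot all_order all_fingroup all_algebra all_field.
From mathcomp Require Import mpoly.
From mathcomp Require Import boolp ring.
From mathcomp Require classical_sets.

Set Implicit Arguments.
Unset Strict Implicit.
Unset Printing Implicit Defensive.

Import GRing.Theory.
Local Open Scope ring_scope.

(** Let S be the polynomial ring, m its maximal ideal and V the space of forms
    of degree d in I.  Since I is m-primary, V has no common zero, so it maps
    the projective space of dimension n - 1 by a finite morphism, and the
    equality of I^t with m^(dt) for large t says that this morphism is a closed
    immersion.  A closed immersion is detected on points and tangent vectors,
    and both can be tested on lines: [separates_on_lines] asks that for two
    independent points a and b over a finite extension L of K some
    L-combination of V restrict to the coordinate t on the line a + t b.  Such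
    a form vanishes at a but not at a + b, and its derivative at a along b is
    nonzero.

    In case (ii) finite extensions of K are trivial, and lines are cut out by
    n - 2 linear forms; modulo these, I contains all forms of degree d
    ([closed_separates]).  In case (i) the linear syzygies phi of the
    generators f, restricted to a line, form a pencil of matrices A + t B that
    kills the vector f(a + t b).  The presentation contains the Koszul syzygies
    f_i e_j - f_j e_i, so this vector spans the kernel of the pencil over L(t);
    it also has no common factor.  Kronecker's theorem on pencils then forces
    its d + 1 coefficient vectors to be independent: otherwise they would span
    a space in which a dimension count finds a kernel vector of smaller degree
    ([pencil_kernel_coefficients_free]).  Hence the restrictions of the f_i
    span all polynomials of degree at most d
    ([linearly_presented_separates]).

    To pass from lines to powers, fix a point P with coordinates in a field L.
    Separation shows that in large degrees every form that vanishes at P lies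
    in the ideal generated by the space V_P of forms in V that vanish at P
    ([vanishing_forms_generated]): separation of tangent vectors gives this
    near P, and separation of points together with the Nullstellensatz away
    from P.  If f0 in V is nonzero at P and S_e denotes the forms of large
    degree e = d t, this reads f0 S_e <= L f0^(t+1) + V_P S_e.  Multiplying by
    the adjugate of the resulting linear system (Nakayama's lemma) yields a
    determinant f in I^r with f(P) <> 0 and f S_e <= I^(r+t)
    ([local_conductor]).  This inclusion is linear, so taking coordinates over K
    brings f down to K.

    The polynomials f that multiply all forms of degree d s - deg f into I^s
    for large s generate an ideal, which by the above has no nontrivial zero
    over any finite extension of K.  By the Nullstellensatz it contains a power
    of every variable, so every monomial of degree d s lies in I^s for large s
    ([maxid_pow_sub_ideal_pow]).

    The Nullstellensatz is proved in a form that suits arbitrary fields: an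
    ideal that contains no power of g has a zero over a finite extension of K
    at which g does not vanish ([nullstellensatz]). *)

(** * Ideals, radicals and powers *)

Section IdealBasics.
Variable R : comNzRingType.
Implicit Types I J G : R -> Prop.

Lemma is_ideal0 I : is_ideal I -> I 0.
Proof. by case. Qed.

Lemma is_idealD I x y : is_ideal I -> I x -> I y -> I (x + y).
Proof. by case=> _ h _; apply: h. Qed.

Lemma is_idealMl I a x : is_ideal I -> I x -> I (a * x).
Proof. by case=> _ _; apply. Qed.

Lemma is_idealMr I a x : is_ideal I -> I x -> I (x * a).
Proof. by rewrite mulrC; apply: is_idealMl. Qed.

Lemma is_idealN I x : is_ideal I -> I x -> I (- x).
Proof. by move=> hI Ix; rewrite -mulN1r; apply: is_idealMl. Qed.

Lemma is_idealB I x y : is_ideal I -> I x -> I y -> I (x - y).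
Proof. by move=> hI Ix Iy; apply: is_idealD => //; apply: is_idealN. Qed.

Lemma is_ideal_sum I (T : Type) (r : seq T) (Q : pred T) (F : T -> R) :
  is_ideal I -> (forall k, Q k -> I (F k)) -> I (\sum_(k <- r | Q k) F k).
Proof.
move=> hI hF; elim/big_rec: _ => [|k x Qk Ix]; first exact: is_ideal0.
by apply: is_idealD => //; apply: hF.
Qed.

Lemma ideal_gen_ideal G : is_ideal (ideal_gen G).
Proof.
split=> [J hJ _|x y Gx Gy J hJ GJ|a x Gx J hJ GJ]; first exact: is_ideal0.
  by apply: is_idealD => //; [apply: Gx | apply: Gy].
by apply: is_idealMl => //; apply: Gx.
Qed.

Lemma sub_ideal_gen G x : G x -> ideal_gen G x.
Proof. by move=> Gx J hJ; apply. Qed.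

Lemma ideal_gen_le G J : is_ideal J -> ideal_le G J -> ideal_le (ideal_gen G) J.
Proof. by move=> hJ GJ x; apply. Qed.

End IdealBasics.

Section Radical.
Variables (R : comNzRingType) (J : R -> Prop) (hJ : is_ideal J).

Lemma is_idealX x k l : J (x ^+ k) -> (k <= l)%N -> J (x ^+ l).
Proof. by move=> Jx /subnK <-; rewrite exprD; apply: is_idealMl. Qed.

Lemma radical_ideal : is_ideal (radical J).
Proof.
split=> [|x y [k Jx] [l Jy]|a x [k Jx]].
- by exists 1%N; rewrite expr1; apply: is_ideal0.
- exists (k + l)%N; rewrite exprDn; apply: is_ideal_sum => // j _.
  rewrite -mulr_natl; apply: is_idealMl => //.
  have [lj|jl] := leqP l j; first by apply: (is_idealMl _ hJ); apply: is_idealX Jy _.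
  apply: (is_idealMr _ hJ); apply: is_idealX Jx _.
  by rewrite -addnBA ?leq_addr // ltnW.
- by exists k; rewrite exprMn; apply: is_idealMl.
Qed.

End Radical.

Section IdealPowers.
Variable R : comNzRingType.
Implicit Types I J : R -> Prop.

Lemma ideal_pow_ideal I t : is_ideal (ideal_pow I t).
Proof. by case: t => [|t]; [split | apply: ideal_gen_ideal]. Qed.

Lemma colon_ideal J x : is_ideal J -> is_ideal (fun y => J (x * y)).
Proof.
move=> hJ; split=> [|y z Jy Jz|a y Jy]; first by rewrite mulr0; apply: is_ideal0.
  by rewrite mulrDr; apply: is_idealD.
by rewrite mulrCA; apply: is_idealMl.
Qed.

Lemma ideal_powS I t x y : I x -> ideal_pow I t y -> ideal_pow I t.+1 (x * y).
Proof. by move=> Ix Iy; apply: sub_ideal_gen; exists x, y. Qed.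

(** The induction principle for powers of an ideal: J need only absorb products
    of one element of I and one of the lower power. *)
Lemma ideal_powS_le I t J : is_ideal J ->
  (forall x y, I x -> ideal_pow I t y -> J (x * y)) ->
  ideal_le (ideal_pow I t.+1) J.
Proof.
by move=> hJ hM; apply: ideal_gen_le => // _ [x [y [Ix Iy ->]]]; apply: hM.
Qed.

Lemma ideal_powD I s t x y :
  ideal_pow I s x -> ideal_pow I t y -> ideal_pow I (s + t) (x * y).
Proof.
move=> Isx Ity; elim: s x Isx => [|s IH] x.
  by move=> _; apply: (is_idealMl _ (ideal_pow_ideal I t)).
rewrite mulrC; move: x.
apply: (ideal_powS_le (J := fun x => ideal_pow I (s.+1 + t) (y * x))) => [|u v Iu Iv].
  exact/colon_ideal/ideal_pow_ideal.
by rewrite mulrC -mulrA addSn; apply: ideal_powS => //; apply: IH.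
Qed.

Lemma ideal_pow1 I x : I x -> ideal_pow I 1 x.
Proof. by move=> Ix; rewrite -[x]mulr1; apply: ideal_powS. Qed.

Lemma ideal_powX I x t : I x -> ideal_pow I t (x ^+ t).
Proof. by move=> Ix; elim: t => // t IH; rewrite exprS; apply: ideal_powS. Qed.

Lemma ideal_pow_prod I (T : finType) (x : T -> R) :
  (forall k, I (x k)) -> ideal_pow I #|T| (\prod_k x k).
Proof.
move=> Ix; rewrite cardE /index_enum -enumT.
by elim: (enum T) => [|k s IH]; rewrite ?big_nil // big_cons; apply: ideal_powS.
Qed.

End IdealPowers.

Section FamilyIdeal.
Variables (R : comNzRingType) (n : nat) (y : 'I_n -> R).

(** For [y] the variables this is [maxid]; for the linear forms that vanish at a
    point it is the ideal of that point. *)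
Definition family_ideal : R -> Prop := ideal_gen (fun x => exists k, x = y k).

Lemma mmap1D m m' : mmap1 y (m + m')%MM = mmap1 y m * mmap1 y m'.
Proof. by apply: commr_mmap1_M => k x; apply: mulrC. Qed.

Lemma family_ideal_pow_le e J : is_ideal J ->
  (forall m, mdeg m = e -> J (mmap1 y m)) -> ideal_le (ideal_pow family_ideal e) J.
Proof.
elim: e J => [|e IH] J hJ Jy.
  move=> p _; rewrite -[p]mulr1; apply: is_idealMl => //.
  by rewrite -(mmap11 y); apply: Jy; rewrite mdeg0.
apply: ideal_powS_le => // x z mx mz.
rewrite mulrC; move: x mx.
apply: (ideal_gen_le (J := fun x => J (z * x))) => [|_ [k ->]].
  exact: colon_ideal.
rewrite mulrC; move: z mz.
apply: (IH (fun z => J (y k * z))); first exact: colon_ideal.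
move=> m me; rewrite -[y k](mmap1U y) -mmap1D.
by apply: Jy; rewrite mdegD mdeg1 me.
Qed.

(** Pigeonhole: some exponent of a monomial of degree above the sum of the N_k
    reaches N_k. *)
Lemma monomial_in_ideal J (N : 'I_n -> nat) m : is_ideal J ->
  (forall k, J (y k ^+ N k)) -> (\sum_k N k < mdeg m)%N -> J (mmap1 y m).
Proof.
move=> hJ JN; rewrite mdegE => lt.
have [k Nk] : exists k, (N k <= m k)%N.
  apply: contrapT => h; move: lt; rewrite ltnNge leq_sum // => k _.
  by rewrite leqNgt; apply/negP => mk; apply: h; exists k; rewrite ltnW.
rewrite /mmap1 (bigD1 k) //=; apply: is_idealMr => //.
exact: is_idealX Nk.
Qed.

Lemma monomial_in_radical J : is_ideal J -> (forall k, radical J (y k)) ->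
  exists N, forall m, (N < mdeg m)%N -> J (mmap1 y m).
Proof.
move=> hJ /fin_all_exists[N JN]; exists (\sum_k N k)%N => m.
exact: monomial_in_ideal.
Qed.

End FamilyIdeal.

Section IdealSum.
Variables (R : comNzRingType) (I J : R -> Prop).
Hypotheses (hI : is_ideal I) (hJ : is_ideal J).

Lemma ideal_add_ideal : is_ideal (ideal_add I J).
Proof.
split.
- by exists 0, 0; split; [exact: is_ideal0 | exact: is_ideal0 | rewrite addr0].
- move=> _ _ [x [z [Ix Jz ->]]] [x' [z' [Ix' Jz' ->]]].
  by exists (x + x'), (z + z'); split; [exact: is_idealD | exact: is_idealD | rewrite addrACA].
- move=> a _ [x [z [Ix Jz ->]]]; exists (a * x), (a * z).
  by split; [exact: is_idealMl | exact: is_idealMl | rewrite mulrDr].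
Qed.

Lemma ideal_addl x : I x -> ideal_add I J x.
Proof. by exists x, 0; split=> //; [exact: is_ideal0 | rewrite addr0]. Qed.

Lemma ideal_addr x : J x -> ideal_add I J x.
Proof. by exists 0, x; split=> //; [exact: is_ideal0 | rewrite add0r]. Qed.

End IdealSum.

(** Each term of the Leibniz expansion is a product of r entries. *)
Lemma ideal_pow_det (R : comNzRingType) (I : R -> Prop) r (A : 'M[R]_r) :
  is_ideal I -> (forall i j, I (A i j)) -> ideal_pow I r (\det A).
Proof.
move=> hI IA; apply: is_ideal_sum => [|s _]; first exact: ideal_pow_ideal.
apply: is_idealMl; first exact: ideal_pow_ideal.
by have := @ideal_pow_prod _ I 'I_r (fun k => A k (s k)) (fun k => IA _ _); rewrite card_ord.
Qed.

(** * Finite extensions of fields *)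

(** The extension is given with a finite generating family [e] and K-linear
    coordinate functions [c] on it, so that identities over L can be read off
    coordinatewise over K.  Stated for a bare ring morphism, the notion composes
    without changing the scalar structure of L. *)
Definition finite_extension (K L : fieldType) (i : {rmorphism K -> L}) : Prop :=
  exists (T : finType) (e : T -> L) (c : T -> {additive L -> K}),
    (forall k a x, c k (i a * x) = a * c k x)
    /\ (forall x, x = \sum_k i (c k x) * e k).

Lemma finite_extension_id (K : fieldType) : finite_extension (idfun : {rmorphism K -> K}).
Proof.
exists unit, (fun=> 1), (fun=> idfun); split=> //= x.
by rewrite (bigD1 tt) //= big1 ?addr0 ?mulr1 // => -[].
Qed.

Lemma finite_extension_comp (K L M : fieldType)
    (i : {rmorphism K -> L}) (j : {rmorphism L -> M}) :
  finite_extension i -> finite_extension j -> finite_extension (j \o i).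
Proof.
move=> [T [e [c [cZ cE]]]] [T' [e' [c' [cZ' cE']]]].
exists (T' * T)%type, (fun k => j (e k.2) * e' k.1), (fun k => c k.2 \o c' k.1).
split=> [k a x|x] /=; first by rewrite cZ' cZ.
rewrite {1}(cE' x) -(pair_big xpredT xpredT (fun k l =>
  j (i (c l (c' k x))) * (j (e l) * e' k))) /=.
apply: eq_bigr => k _; rewrite {1}(cE (c' k x)) rmorph_sum mulr_suml.
by apply: eq_bigr => l _; rewrite rmorphM mulrA.
Qed.

Lemma exists_min_size (R : nzSemiRingType) (Q : {poly R} -> Prop) :
  (exists p, Q p) -> exists p, Q p /\ forall q, Q q -> (size p <= size q)%N.
Proof.
move=> [p Qp].
pose s n := `[< exists2 q, Q q & size q = n >].
have exs : exists n, s n by exists (size p); apply/asboolP; exists p.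
case: (ex_minnP exs) => n /asboolP[q Qq <-] hmin; exists q; split=> // r Qr.
by apply: hmin; apply/asboolP; exists r.
Qed.

Lemma exists_irreducible_factor (F : fieldType) (p : {poly F}) :
  (1 < size p)%N -> exists q, irreducible_poly q /\ q %| p.
Proof.
move=> p_gt1.
have [q [[q_gt1 qp] qmin]] := @exists_min_size F (fun q => (1 < size q)%N /\ q %| p)
  (ex_intro _ p (conj p_gt1 (dvdpp p))).
exists q; split=> //; split=> // r r1 rq.
have q0 : q != 0 by rewrite -size_poly_gt0 ltnW.
have r0 : r != 0 by apply: contraNneq q0 => r0; move: rq; rewrite r0 dvd0p.
rewrite -dvdp_size_eqp //; apply/eqP/anti_leq/andP; split.
  exact: dvdp_leq.
apply: qmin; split; last exact: dvdp_trans qp.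
by rewrite ltn_neqAle eq_sym r1 size_poly_gt0.
Qed.

Lemma adjoin_root (K : fieldType) (p : {poly K}) : (1 < size p)%N ->
  exists (L : fieldType) (i : {rmorphism K -> L}) (z : L),
    finite_extension i /\ root (map_poly i p) z.
Proof.
move=> /exists_irreducible_factor[q [q_irr qp]].
have [L _ [z rz _]] := irredp_FAdjoin q_irr.
exists L, (in_alg L), z; split; last first.
  by apply: root_dvdp rz; rewrite dvdp_map.
pose b := vbasis {:L}.
exists 'I_(\dim {:L}), (fun k : 'I_(\dim {:L}) => b`_k), (fun k => coord b k).
split=> [k a x|x] /=; first by rewrite mulr_algl linearZ.
rewrite {1}(coord_vbasis (memvf x)).
by apply: eq_bigr => k _; rewrite mulr_algl.
Qed.

Lemma closed_field_root (K : fieldType) (p : {poly K}) :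
  GRing.closed_field_axiom K -> (1 < size p)%N -> exists a, root p a.
Proof.
move=> hK sp; have p0 : p != 0 by rewrite -size_poly_gt0 ltnW.
have [|a Ea] := hK (size p).-1 (fun k => - (p`_k / lead_coef p)).
  by rewrite -ltnS prednK // ltnW.
exists a; rewrite /root horner_coef -(prednK (ltnW sp)) big_ord_recr /= Ea.
rewrite mulr_sumr -big_split big1 //= => k _.
rewrite !mulNr mulrN mulrA [_ * (p`_k / _)]mulrCA -lead_coefE mulfV ?lead_coef_eq0 //.
by rewrite mulr1 subrr.
Qed.

(** The multiplication by x has a matrix with entries in K with respect to the
    generating family, so x is a root of its characteristic polynomial, which
    splits over K. *)
Lemma closed_field_extension (K L : fieldType) (i : {rmorphism K -> L}) :
  GRing.closed_field_axiom K -> finite_extension i -> forall x, exists a, x = i a.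
Proof.
move=> hK [T [e [c [_ cE]]]] x.
have splits (p : {poly K}) : p != 0 -> root (map_poly i p) x -> exists a, x = i a.
  move: {2}(size p).+1 (ltnSn (size p)) => N; elim: N p => // N IH p pN p0 rx.
  have sp : (1 < size p)%N.
    rewrite ltnNge; apply/negP => /size1_polyC E; move: p0 rx.
    by rewrite E map_polyC /root hornerC /= polyC_eq0 fmorph_eq0 => /negbTE ->.
  have [a /factor_theorem[q E]] := closed_field_root hK sp.
  have q0 : q != 0 by apply: contraNneq p0 => q0; rewrite E q0 mul0r.
  move: rx; rewrite E rmorphM /root hornerM mulf_eq0 => /orP[|].
    apply: IH => //; move: pN.
    by rewrite E size_mul ?polyXsubC_eq0 // size_XsubC addn2 ltnS.
  rewrite /= map_polyXsubC -[_ == 0]/(root _ _) root_XsubC => /eqP ->.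
  by exists a.
pose M := \matrix_(l < #|T|, k < #|T|) c (enum_val l) (x * e (enum_val k)).
pose E := \row_(k < #|T|) e (enum_val k).
apply: (splits (char_poly M)); first by rewrite monic_neq0 ?char_poly_monic.
rewrite map_char_poly -eigenvalue_root_char; apply/eigenvalueP; exists E.
  apply/rowP => k; rewrite !mxE [RHS](cE (x * e (enum_val k))).
  rewrite [RHS](reindex _ (onW_bij _ (enum_val_bij T))) /=.
  by apply: eq_bigr => l _; rewrite !mxE mulrC.
apply/eqP => /rowP E0; have /eqP[] := oner_neq0 L; rewrite (cE 1) big1 // => k _.
by have := E0 (enum_rank k); rewrite !mxE enum_rankK => ->; rewrite mulr0.
Qed.

(** * Zeros in finite extensions *)

Section PrimeAvoiding.
Variable A : comNzRingType.

Definition prime_ideal (P : A -> Prop) : Prop :=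
  [/\ is_ideal P, ~ P 1 & forall x y, P (x * y) -> P x \/ P y].

Lemma prime_idealX P x k : prime_ideal P -> P (x ^+ k) -> P x.
Proof.
case=> hP nP1 hM; elim: k => [|k IH]; first by rewrite expr0 => /nP1.
by rewrite exprS => /hM[].
Qed.

(** Zorn's lemma gives an ideal P maximal among those that contain J and no power
    of g.  It is prime: if x and y are not in P, powers of g lie in P + (x) and
    in P + (y), hence their product lies in P + (x y),
    so x y is not in P either. *)
Lemma exists_prime_avoiding (J : A -> Prop) (g : A) :
  is_ideal J -> (forall k, ~ J (g ^+ k)) ->
  exists P, [/\ prime_ideal P, ideal_le J P & ~ P g].
Proof.
move=> hJ hg.
pose ok (I : A -> Prop) :=
  [/\ is_ideal I, ideal_le J I & forall k, ~ I (g ^+ k)].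
pose T := {I : A -> Prop | ok I}.
pose le (U V : T) := `[< ideal_le (sval U) (sval V) >].
have okJ : ok J by split.
have [||F totF|M maxM] := @classical_sets.ZL_preorder T (exist _ J okJ) le.
- by move=> U; apply/asboolP.
- move=> U V W /asboolP UV /asboolP VW; apply/asboolP=> x /UV; exact: VW.
- have [[U0 FU0]|noF] := pselect (exists U, F U); last first.
    by exists (exist _ J okJ) => U FU; case: noF; exists U.
  pose W x := exists2 U : T, F U & sval U x.
  suff okW : ok W.
    by exists (exist _ W okW) => U FU; apply/asboolP=> x Ux; exists U.
  split; last by move=> k [U _ Ug]; case: (svalP U) => _ _ /(_ k).
    split=> [|x y [U FU Ux] [V FV Vy]|a x [U FU Ux]].
    - by exists U0 => //; apply: is_ideal0; case: (svalP U0).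
    - case: (totF _ _ FU FV) => /asboolP sub.
        exists V => //; apply: is_idealD => //; first by case: (svalP V).
        exact: sub.
      exists U => //; apply: is_idealD => //; first by case: (svalP U).
      exact: sub.
    by exists U => //; apply: is_idealMl => //; case: (svalP U).
  by move=> x Jx; exists U0 => //; case: (svalP U0) => _ /(_ x Jx).
have [hM JM gM] := svalP M; set P := sval M in hM JM gM.
exists P; split=> //; last by move/(_ 1%N): gM; rewrite expr1.
split=> //; first by move/(_ 0%N): gM; rewrite expr0.
move=> x y Pxy; have [Px|nPx] := pselect (P x); first by left.
right; apply: contrapT => nPy.
(* Maximality: adding z to P must produce a power of g. *)
have big z : ~ P z -> exists k m a, P m /\ g ^+ k = m + a * z.
  move=> nPz; apply: contrapT => hno.
  pose W w := exists m a, P m /\ w = m + a * z.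
  have okW : ok W.
    split.
    - split=> [|u v [m [a [Pm ->]]] [m' [a' [Pm' ->]]]|c u [m [a [Pm ->]]]].
      + by exists 0, 0; split; [exact: is_ideal0 | rewrite mul0r addr0].
      + exists (m + m'), (a + a'); split; first exact: is_idealD.
        by rewrite mulrDl addrACA.
      + exists (c * m), (c * a); split; first exact: is_idealMl.
        by rewrite mulrDr mulrA.
    - by move=> w /JM Pw; exists w, 0; rewrite mul0r addr0.
    - by move=> k [m [a [Pm gk]]]; case: hno; exists k, m, a.
  have /asboolP : le (exist _ W okW) M.
    apply: maxM; apply/asboolP=> w Pw.
    by exists w, 0; rewrite mul0r addr0.
  by move/(_ z) => WP; apply/nPz/WP; exists 0, 1; split; [exact: is_ideal0 | rewrite mul1r add0r].
have [k [m [a [Pm gk]]]] := big _ nPx.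
have [l [m' [b [Pm' gl]]]] := big _ nPy.
apply: (gM (k + l)%N); rewrite exprD gk gl mulrDl.
apply: is_idealD => //; first exact: is_idealMr.
rewrite mulrDr; apply: is_idealD => //; first exact: is_idealMl.
by rewrite mulrACA; apply: is_idealMl.
Qed.

End PrimeAvoiding.

Section PointExtension.
Variable K : fieldType.

(** The strong Nullstellensatz for a K-algebra A, with structure map f: every
    prime P and every g outside P are separated by a point of A with values in
    a finite extension of K.  The element g is what makes an induction on the
    number of variables possible. *)
Definition has_points (A : comNzRingType) (f : {rmorphism K -> A}) : Prop :=
  forall (P : A -> Prop) (g : A), prime_ideal P -> ~ P g ->
  exists (L : fieldType) (i : {rmorphism K -> L}) (phi : {rmorphism A -> L}),
    [/\ finite_extension i, forall a, phi (f a) = i a,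
        forall p, P p -> phi p = 0 & phi g != 0].

(** Points transfer along a retraction; a prime of the retract B is pulled back
    to A and the points of A are composed with the section. *)
Lemma has_points_retract (A B : comNzRingType) (f : {rmorphism K -> A})
    (g : {rmorphism K -> B}) (s : {rmorphism B -> A}) (r : {rmorphism A -> B}) :
  (forall b, r (s b) = b) -> (forall a, r (f a) = g a) ->
  (forall a, s (g a) = f a) ->
  has_points f -> has_points g.
Proof.
move=> rs rf sg hA P b [hP P1 PM] nPb.
have [||L [i [phi [iF phif phi0 phib]]]] := hA (fun x => P (r x)) (s b).
- split; last 2 first.
  + by rewrite rmorph1.
  + by move=> x y; rewrite rmorphM => /PM.
  split=> [|x y Px Py|a x Px]; first by rewrite rmorph0; apply: is_ideal0.
    by rewrite rmorphD; apply: is_idealD.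
  by rewrite rmorphM; apply: is_idealMl.
- by rewrite rs.
exists L, i, (phi \o s); split=> //= [a|p Pp]; first by rewrite sg phif.
by apply: phi0; rewrite rs.
Qed.

Section Poly.
Variables (A : comNzRingType) (P : {poly A} -> Prop) (hP : prime_ideal P).

(** The ideal of {poly A} generated by the contraction of P to A.  Congruence
    modulo it stands for computing with polynomials over the domain A / (P cap A),
    which avoids building that quotient. *)
Definition coefs_in (p : {poly A}) : Prop := forall k, P (p`_k)%:P.

Let idP : is_ideal P. Proof. by case: hP. Qed.

Lemma contraction_prime : prime_ideal (fun a => P a%:P).
Proof.
case: hP => _ P1 PM; split.
- split=> [|x y Px Py|a x Px]; first by rewrite polyC0; apply: is_ideal0.
    by rewrite polyCD; apply: is_idealD.
  by rewrite polyCM; apply: is_idealMl.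
- by [].
- by move=> x y; rewrite polyCM => /PM.
Qed.

Let idP0 : is_ideal (fun a => P a%:P).
Proof. by case: contraction_prime. Qed.

Lemma coefs_in_ideal : is_ideal coefs_in.
Proof.
split=> [k|p q hp hq k|a p hp k]; first by rewrite coef0; apply: (is_ideal0 idP0).
  by rewrite coefD; apply: (is_idealD idP0).
rewrite coefM; apply: (@is_ideal_sum _ (fun a => P a%:P)) => // i _.
  exact: (is_idealMl _ idP0).
Qed.

Lemma coefs_in_sub p : coefs_in p -> P p.
Proof.
move=> hp; rewrite -[p]coefK poly_def; apply: is_ideal_sum => // k _.
by rewrite -mul_polyC mulrC; apply: (is_idealMl _ idP); apply: hp.
Qed.

(** Dropping the top coefficients that lie in P gives a congruent polynomial whose
    size measures the degree over A / (P cap A). *)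
Lemma coefs_in_strip p : ~ coefs_in p ->
  exists q, [/\ coefs_in (p - q), (size q <= size p)%N & ~ P (lead_coef q)%:P].
Proof.
move=> np.
have [k nPk] : exists k, ~ P (p`_k)%:P by apply/existsNP.
pose s n := `[< ~ P (p`_n)%:P >].
have exs : exists n, s n by exists k; apply/asboolP.
have hle n : s n -> (n <= size p)%N.
  rewrite leqNgt => /asboolP h; apply/negP => lt; apply: h.
  by rewrite nth_default ?(ltnW lt) //; apply: (is_ideal0 idP0).
case: (ex_maxnP exs hle) => n /asboolP sn nmax.
have pn0 : p`_n != 0.
  by apply: contra_notN sn => /eqP ->; apply: (is_ideal0 idP0).
pose q := \poly_(i < n.+1) p`_i.
have sq : size q = n.+1 by rewrite size_poly_eq.
exists q; split.
- move=> i; rewrite coefB coef_poly ltnS; case: leqP => hi.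
    by rewrite subrr; apply: (is_ideal0 idP0).
  rewrite subr0; apply: contrapT => h.
  have: s i by apply/asboolP.
  by move/nmax; rewrite leqNgt hi.
- by rewrite sq ltnNge; apply: contra pn0 => h; rewrite nth_default.
- by rewrite lead_coefE sq /= coef_poly ltnSn.
Qed.

Lemma min_size_lead_coef f : ~ coefs_in f ->
  (forall q, coefs_in (f - q) -> ~ coefs_in q -> (size f <= size q)%N) ->
  ~ P (lead_coef f)%:P.
Proof.
move=> nf fmin; have [q [fq sq nq]] := coefs_in_strip nf.
have ncq : ~ coefs_in q by move=> h; apply: nq; rewrite lead_coefE; apply: h.
have sfq : size q = size f by apply/eqP; rewrite eqn_leq sq fmin.
rewrite lead_coefE => h; apply: nq; rewrite lead_coefE sfq.
rewrite -[q](subKr f) coefB polyCB; apply: is_idealB => //; exact: fq.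
Qed.

Lemma pseudo_divide (w p : {poly A}) : w != 0 ->
  exists k q r, (lead_coef w ^+ k)%:P * p = q * w + r /\ (size r < size w)%N.
Proof.
move=> w0; exists (Pdiv.Ring.rscalp p w), (Pdiv.Ring.rdivp p w), (Pdiv.Ring.rmodp p w).
by rewrite mul_polyC Pdiv.ComRing.rdivp_eq Pdiv.Ring.ltn_rmodp.
Qed.

(** Over the fraction field of A / (P cap A), the polynomial f generates the
    extension of P and g is prime to it, so a Bezout relation between f and g
    exists; here it is written with a denominator c.  Without fractions, it is
    the element w of least degree of the ideal (f, g) modulo [coefs_in] that has
    to be constant: f is a multiple q w up to a power of the leading coefficient
    of w, w is not in P because g is not, so q is in P and has at least the
    degree of f. *)
Lemma prime_poly_eliminant f g : P f -> ~ coefs_in f ->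
  (forall q, P q -> ~ coefs_in q -> (size f <= size q)%N) -> ~ P g ->
  exists c u v r, [/\ ~ P c%:P, coefs_in r & c%:P = u * f + v * g + r].
Proof.
move=> Pf nf fmin nPg.
have idC := coefs_in_ideal.
pose D w := exists u v r, coefs_in r /\ w = u * f + v * g + r.
have idD : is_ideal D.
  split.
  - by exists 0, 0, 0; rewrite !mul0r !addr0; split=> //; apply: (is_ideal0 idC).
  - move=> x y [u [v [r [hr ->]]]] [u' [v' [r' [hr' ->]]]].
    exists (u + u'), (v + v'), (r + r'); split; first exact: (is_idealD idC).
    by rewrite !mulrDl [LHS]addrACA [X in X + _]addrACA.
  - move=> a x [u [v [r [hr ->]]]]; exists (a * u), (a * v), (a * r).
    by split; [apply: (is_idealMl _ idC) | rewrite !mulrDr !mulrA].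
have Dc r : coefs_in r -> D r.
  by move=> hr; exists 0, 0, r; rewrite !mul0r !add0r.
have Df : D f.
  exists 1, 0, 0; split; first exact: (is_ideal0 idC).
  by rewrite mul1r mul0r !addr0.
have Dg : D g.
  exists 0, 1, 0; split; first exact: (is_ideal0 idC).
  by rewrite mul1r mul0r add0r addr0.
have [|w [[Dw nw] wmin]] := @exists_min_size A (fun w => D w /\ ~ coefs_in w).
  by exists f.
have lw : ~ P (lead_coef w)%:P.
  apply: min_size_lead_coef => // q wq nq; apply: wmin; split=> //.
  by rewrite -[q](subKr w); apply: is_idealB => //; apply: Dc.
have w0 : w != 0 by apply: contra_notN lw => /eqP ->; rewrite lead_coef0 polyC0; apply: is_ideal0.
(* Remainders modulo w of elements of D vanish modulo the contraction of P. *)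
have small x k q r : D x -> (lead_coef w ^+ k)%:P * x = q * w + r ->
    (size r < size w)%N -> coefs_in r.
  move=> Dx E sr; apply: contrapT => nr; move: sr; rewrite ltnNge wmin //.
  split=> //; rewrite (_ : r = (lead_coef w ^+ k)%:P * x - q * w).
    by apply: is_idealB => //; apply: is_idealMl.
  by rewrite E addrAC subrr add0r.
have cancel x k : P ((lead_coef w ^+ k)%:P * x) -> P x.
  case: hP => _ _ PM /PM[|//]; rewrite polyC_exp.
  by move/(prime_idealX hP).
have nPw : ~ P w.
  move=> Pw; have [k [q [r [E sr]]]] := pseudo_divide g w0.
  apply: nPg; apply: (cancel _ k); rewrite E; apply: is_idealD => //.
    exact: is_idealMl.
  exact/coefs_in_sub/(small _ _ _ _ Dg E).
have [k [q [r [E sr]]]] := pseudo_divide f w0.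
have cr := small _ _ _ _ Df E sr.
have Pq : P q.
  case: hP => _ _ PM; have [] // := PM q w.
  rewrite (_ : q * w = (lead_coef w ^+ k)%:P * f - r); last by rewrite E addrK.
  by apply: is_idealB => //; [apply: is_idealMl | apply: coefs_in_sub].
have lf : ~ P (lead_coef f)%:P.
  apply: min_size_lead_coef => // q' fq nq; apply: fmin => //.
  by rewrite -[q'](subKr f); apply: is_idealB => //; apply: coefs_in_sub.
have f0 : f != 0.
  by apply: contra_notN lf => /eqP ->; rewrite lead_coef0 polyC0; apply: is_ideal0.
have nq : ~ coefs_in q.
  move=> cq; have : coefs_in ((lead_coef w ^+ k)%:P * f).
    rewrite E. exact: (is_idealD idC (is_idealMr w idC cq) cr).
  move/(_ (size f).-1); rewrite coefCM -lead_coefE polyCM => /cancel; exact: lf.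
have [q' [qq' sq' lq']] := coefs_in_strip nq.
have sfq : (size f <= size q')%N.
  apply: fmin; last by move=> h; apply: lq'; rewrite lead_coefE; apply: h.
  by rewrite -[q'](subKr q); apply: is_idealB => //; apply: coefs_in_sub.
have sw : (size w <= 1)%N.
  rewrite leqNgt; apply/negP => w1.
  case: hP => _ _ PM.
  have [] // : P (lead_coef q')%:P \/ P (lead_coef w)%:P.
  apply: PM; rewrite -polyCM mul_lead_coef.
  rewrite (_ : q' * w = (lead_coef w ^+ k)%:P * f - (r + (q - q') * w)); last first.
    by rewrite E mulrBl opprD opprB [in RHS]addrA addrK [RHS]addrC subrK.
  rewrite coefB coefCM nth_default ?mulr0 ?sub0r; last first.
    rewrite -!subn1 -subnDA; apply: leq_trans sfq _.
    by rewrite addn1 -addnBA // leq_addr.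
  rewrite polyCN; apply: is_idealN => //.
  exact: (is_idealD idC cr (is_idealMr w idC qq')).
case: Dw => u [v [r' [cr' Ew]]].
exists (lead_coef w), u, v, r'; split=> //.
by rewrite -Ew lead_coefE [in RHS](size1_polyC sw); congr (_`_ _)%:P; case: (size w) sw => [|[]].
Qed.

End Poly.

(** If P is generated by its contraction to A, some coefficient of g avoids that
    contraction; a point of A where it is nonzero extends by any value of the
    variable that is not a root of g.  Otherwise let p in P have minimal degree
    among the polynomials that are nonzero modulo the contraction, and let c be
    the constant of [prime_poly_eliminant].  At a point of A where c and the
    leading coefficient of p are nonzero, the variable is sent to a root of p;
    pseudo-division by p shows that P is killed, and the Bezout relation that g
    is not. *)
Lemma has_points_poly (A : comNzRingType) (f : {rmorphism K -> A}) :
  has_points f -> has_points (polyC \o f).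
Proof.
move=> hA P g hP nPg.
have hP0 := contraction_prime hP.
have idP : is_ideal P by case: hP.
have [allP|/existsNP[f0 /not_implyP[Pf0 nf0]]] :=
  pselect (forall p, P p -> coefs_in P p).
  have [k nPk] : exists k, ~ P (g`_k)%:P.
    by apply/existsNP => /(coefs_in_sub hP); exact: nPg.
  have [L [i [phi [iF phif phi0 phig]]]] := hA _ _ hP0 nPk.
  pose gL := map_poly phi g.
  have gL0 : gL != 0.
    by apply: contra phig => /eqP h; rewrite -coef_map -/gL h coef0.
  (* A root of X g - 1 is not a root of g, and this polynomial is never
     constant. *)
  pose h := 'X * gL - 1.
  have sh : (1 < size h)%N.
    have sX : size ('X * gL) = (size gL).+1 by rewrite mulrC size_mulX.
    by rewrite size_polyDl ?size_polyN ?size_poly1 ?sX // ltnS size_poly_gt0.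
  have [L' [j [z [jF rz]]]] := adjoin_root sh.
  exists L', (j \o i), (horner_eval z \o map_poly (j \o phi)).
  split=> /=; first exact: finite_extension_comp.
  - by move=> a; rewrite map_polyC /= horner_evalE hornerC phif.
  - move=> p Pp; rewrite (_ : map_poly _ p = 0) ?raddf0 //; apply/polyP => l.
    by rewrite coef_map coef0 /= phi0 ?rmorph0 //; apply: allP.
  - rewrite horner_evalE map_poly_comp -/gL.
    apply/eqP => E; move: rz; rewrite /root /h rmorphB rmorphM /= map_polyX.
    by rewrite hornerD hornerM hornerX E mulr0 add0r rmorph1 hornerN hornerC oppr_eq0 oner_eq0.
have [|p [[Pp np] pmin]] := @exists_min_size A (fun p => P p /\ ~ coefs_in P p).
  by exists f0.
have pmin' q : P q -> ~ coefs_in P q -> (size p <= size q)%N.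
  by move=> Pq nq; apply: pmin.
have lp : ~ P (lead_coef p)%:P.
  apply: (min_size_lead_coef hP) => // q fq nq; apply: pmin' => //.
  by rewrite -[q](subKr p); apply: is_idealB => //; apply: (coefs_in_sub hP).
have p0 : p != 0.
  by apply: contra_notN lp => /eqP ->; rewrite lead_coef0 polyC0; apply: is_ideal0.
have [c [u [v [r [nPc cr E]]]]] := prime_poly_eliminant hP Pp np pmin' nPg.
have nPcl : ~ P (c * lead_coef p)%:P.
  by case: hP0 => _ _ PM /PM[].
have [L [i [phi [iF phif phi0]]]] := hA _ _ hP0 nPcl.
rewrite rmorphM mulf_eq0 negb_or => /andP[phic phil].
have sp : (1 < size p)%N.
  rewrite ltnNge; apply/negP => sp; apply: lp.
  move: Pp; rewrite lead_coefE [in X in P X -> _](size1_polyC sp).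
  by case: (size p) sp => [|[]].
have sL : size (map_poly phi p) = size p by rewrite size_map_poly_id0.
have [L' [j [z [jF rz]]]] : exists (L' : fieldType) (j : {rmorphism L -> L'}) z,
    finite_extension j /\ root (map_poly j (map_poly phi p)) z.
  by apply: adjoin_root; rewrite sL.
pose psi := (horner_eval z \o map_poly (j \o phi)).
have psiC a : psi a%:P = j (phi a).
  by rewrite /psi /= map_polyC /= horner_evalE hornerC.
have psiM x y : psi (x * y) = psi x * psi y by rewrite /psi rmorphM.
have psiD x y : psi (x + y) = psi x + psi y by rewrite /psi rmorphD.
have psi_c q : coefs_in P q -> psi q = 0.
  move=> cq; rewrite /psi /= (_ : map_poly _ q = 0) ?raddf0 //; apply/polyP => l.
  by rewrite coef_map coef0 /= phi0 ?rmorph0.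
have psip : psi p = 0.
  by rewrite /psi /= map_poly_comp horner_evalE; apply/eqP.
exists L', (j \o i), psi; split; first exact: finite_extension_comp.
- by move=> a /=; rewrite -phif -psiC.
- move=> q Pq; have [k [s [t [Eq st]]]] := pseudo_divide q p0.
  have ct : coefs_in P t.
    apply: contrapT => nt; move: st; rewrite ltnNge pmin' //.
    rewrite (_ : t = (lead_coef p ^+ k)%:P * q - s * p).
      by apply: is_idealB => //; apply: is_idealMl.
    by rewrite Eq addrAC subrr add0r.
  have := congr1 psi Eq; rewrite psiM psiC psiD psiM psip mulr0 (psi_c _ ct) addr0.
  by move/eqP; rewrite mulf_eq0 fmorph_eq0 rmorphXn expf_eq0 (negbTE phil) andbF => /eqP.
- have := congr1 psi E; rewrite psiC !psiD !psiM psip mulr0 add0r (psi_c _ cr) addr0.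
  move=> h; apply/eqP => g0; case/negP: phic.
  by rewrite -(fmorph_eq0 j) h [X in _ * X]g0 mulr0.
Qed.

Lemma has_points_mpoly n : has_points (@mpolyC n K).
Proof.
elim: n => [|n IH].
  move=> P g hP nPg; exists K, idfun, (meval (fun=> 0)).
  have C0 (p : {mpoly K[0]}) : p = (p@_0)%:MP.
    apply/mpolyP => m; rewrite (_ : m = 0%MM); last by apply/mnmP => -[].
    by rewrite mcoeffC eqxx mulr1.
  split; first exact: finite_extension_id.
  - by move=> a; rewrite /= mevalC.
  - move=> p Pp /=; rewrite [p]C0 mevalC; apply/eqP.
    apply: contraT => c0; case: hP => hP P1 _; case: P1.
    suff -> : 1 = (p@_0)^-1%:MP * p by apply: is_idealMl.
    by have := C0 p; set c := p@_0 in c0 * => ->; rewrite -mpolyCM mulVf.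
  - rewrite /= [g]C0 mevalC; apply: contra_notN nPg => /eqP c0.
    by rewrite [g]C0 c0 mpolyC0; apply: is_ideal0; case: hP.
apply: (has_points_retract (s := @muni n K)
    (r := horner_eval 'X_ord_max \o map_poly (@mwiden n K))) (has_points_poly IH).
- move=> p /=; rewrite muniE !rmorph_sum /= [RHS]mpolyE; apply: eq_bigr => m _.
  rewrite map_polyZ map_polyXn /= mwidenZ mwidenX horner_evalE hornerZ hornerXn.
  rewrite -scalerAl; congr (_ *: _); rewrite mpolyXn -mpolyXD; congr 'X_[_].
  apply/mnmP => i; rewrite mnmDE mulmnE mnm1E.
  case: (unliftP ord_max i) => [j ->|->].
    rewrite (_ : lift ord_max j = widen_ord (leqnSn n) j); last first.
      by apply/val_inj; rewrite /= /bump leqNgt ltn_ord.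
    rewrite mnmwiden_widen mnmE; case: eqP => [/(congr1 val)/= h|_].
      by have := ltn_ord j; rewrite -h ltnn.
    by rewrite mul0n addn0.
  by rewrite mnmwiden_ordmax eqxx mul1n.
- by move=> a /=; rewrite map_polyC /= horner_evalE hornerC mwidenC.
- by move=> a /=; rewrite muniC.
Qed.

End PointExtension.

Lemma rmorphism_mpolyE (K : fieldType) (A : comNzRingType) n
    (i : {rmorphism K -> A}) (phi : {rmorphism {mpoly K[n]} -> A}) p :
  (forall a, phi a%:MP = i a) -> phi p = mmap i (fun k => phi 'X_k) p.
Proof.
move=> phiC; rewrite [in LHS](mpolyE p) rmorph_sum; apply: eq_bigr => m _.
rewrite -mul_mpolyC rmorphM phiC; congr (_ * _).
rewrite mpolyXE_id rmorph_prod; apply: eq_bigr => k _; exact: rmorphXn.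
Qed.

Lemma mmap_meval (K : fieldType) (L : comNzRingType) n (i : {rmorphism K -> L}) v
    (p : {mpoly K[n]}) : (map_mpoly i p).@[v] = mmap i v p.
Proof.
have phiC a : (meval v \o map_mpoly i) (a%:MP : {mpoly K[n]}) = i a.
  by rewrite /= map_mpolyC mevalC.
rewrite [LHS](rmorphism_mpolyE p phiC); apply: eq_bigr => m _; congr (_ * _).
by apply: mmap1_eq => k; rewrite /= map_mpolyX mevalXU.
Qed.

(** A prime that contains J and avoids g exists because no power of g lies in J;
    its points are the required zeros. *)
Theorem nullstellensatz (K : fieldType) n (J : {mpoly K[n]} -> Prop) g :
  is_ideal J -> (forall k, ~ J (g ^+ k)) ->
  exists (L : fieldType) (i : {rmorphism K -> L}) (v : 'I_n -> L),
    [/\ finite_extension i, forall p, J p -> mmap i v p = 0 & mmap i v g != 0].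
Proof.
move=> hJ hg; have [P [hP JP nPg]] := exists_prime_avoiding hJ hg.
have [L [i [phi [iF phiC phi0 phig]]]] := has_points_mpoly hP nPg.
exists L, i, (fun k => phi 'X_k); split=> // [p Jp|].
  by rewrite -(rmorphism_mpolyE _ phiC); apply/phi0/JP.
by rewrite -(rmorphism_mpolyE _ phiC).
Qed.

Lemma mmap_map_mpoly (K L : fieldType) (A : comNzRingType) n (i : {rmorphism K -> L})
    (j : {rmorphism L -> A}) (h : 'I_n -> A) (p : {mpoly K[n]}) :
  mmap j h (map_mpoly i p) = mmap (j \o i) h p.
Proof.
have phiC a : (mmap j h \o map_mpoly i) (a%:MP : {mpoly K[n]}) = (j \o i) a.
  by rewrite /= map_mpolyC mmapC.
rewrite [LHS](rmorphism_mpolyE p phiC); apply: eq_bigr => m _; congr (_ * _).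
by apply: mmap1_eq => k; rewrite /= map_mpolyX mmapX mmap1U.
Qed.

(** * Linear algebra: subspaces and pencils *)

(** Subspaces given as mere propositions are row spaces: take a matrix of maximal
    rank among those with row space inside [U]. *)
Lemma row_subspace (F : fieldType) n (U : 'rV[F]_n -> Prop) :
  U 0 -> (forall c v w, U v -> U w -> U (c *: v + w)) ->
  exists A : 'M[F]_n, forall v, U v <-> (v <= A)%MS.
Proof.
move=> U0 UD.
pose ok r := `[< exists A : 'M[F]_n, \rank A = r /\ forall v, (v <= A)%MS -> U v >].
have ok0 : exists r, ok r.
  exists 0%N; apply/asboolP; exists 0; split=> [|v]; first exact: mxrank0.
  by rewrite submx0 => /eqP ->.
have okn r : ok r -> (r <= n)%N by move=> /asboolP[A [<- _]]; apply: rank_leq_row.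
case: (ex_maxnP ok0 okn) => r /asboolP[A [Ar AU]] rmax.
exists A => v; split=> [Uv|]; last exact: AU.
apply: contraT => nvA; suff /rmax : ok (\rank (A + v)%MS).
  rewrite -Ar leqNgt => /negP[]; rewrite ltn_neqAle mxrankS ?addsmxSl // andbT.
  rewrite (mxrank_leqif_sup (addsmxSl A v)).2; apply: contra nvA.
  exact: submx_trans (addsmxSr A v).
apply/asboolP; exists (A + v)%MS; split=> // w /sub_addsmxP[[w1 w2] /= ->].
rewrite addrC (mx11_scalar w2) mul_scalar_mx; apply: UD => //.
by apply: AU; apply: submxMl.
Qed.

Section Pencil.
Variables (F : fieldType) (m n : nat).
Implicit Types (A B : 'M[F]_(m, n)) (f g : 'I_m -> {poly F}).

Definition in_pencil_kernel A B f : Prop :=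
  forall j, \sum_i f i * ((A i j)%:P + (B i j)%:P * 'X) = 0.

Lemma coef_pencil A B f j k :
  (\sum_i f i * ((A i j)%:P + (B i j)%:P * 'X))`_k
  = \sum_i (f i)`_k * A i j
    + (if k is l.+1 then \sum_i (f i)`_l * B i j else 0).
Proof.
rewrite coef_sum; case: k => [|k].
  rewrite addr0; apply: eq_bigr => i _.
  by rewrite mulrDr coefD coefMC mulrA coefMX addr0.
rewrite -big_split /=; apply: eq_bigr => i _.
by rewrite mulrDr coefD coefMC mulrA coefMX /= coefMC.
Qed.

(** Look for g = sum_(l < r) X^l g_l with the g_l in the row space of U, which has
    dimension r.  The unknowns form an r x r matrix.  The coefficients of
    g (A + X B) at X^0, ..., X^r lie in the row space of U A, of dimension
    s < r, so the equations number (r + 1) s <= r^2 - 1. *)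
Lemma short_pencil_kernel r (A B : 'M[F]_(m, n)) (U : 'M[F]_(r, m)) :
  row_free U -> (\rank (U *m A) < r)%N -> (U *m B <= U *m A)%MS ->
  exists g, [/\ in_pencil_kernel A B g, forall i, (size (g i) <= r)%N
             & exists i, g i != 0].
Proof.
move=> U_free rk /submxP[Q0 UB].
have {rk} [s [E [P [rk UA]]]] : exists s (E : 'M[F]_(s, n)) (P : 'M[F]_(r, s)),
    (s < r)%N /\ U *m A = P *m E.
  have [P UA] : exists P, U *m A = P *m row_base (U *m A).
    by apply/submxP; rewrite eq_row_base.
  by exists (\rank (U *m A)), (row_base (U *m A)), P.
have {}UB : U *m B = (Q0 *m P) *m E by rewrite UB UA mulmxA.
move: (Q0 *m P) UB => Q UB.
(* S0 and S1 pad a sequence of r coefficients by a zero at the end, resp. at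
   the start, so that Phi computes the coefficients of the product. *)
pose S0 : 'M[F]_(r.+1, r) := \matrix_(k, l) (k == l :> nat)%:R.
pose S1 : 'M[F]_(r.+1, r) := \matrix_(k, l) (k == l.+1 :> nat)%:R.
pose Phi (X : 'M[F]_r) := S0 *m X *m P + S1 *m X *m Q.
pose PhiM : {linear 'M[F]_r -> 'M[F]_(r.+1, s)} :=
  (mulmxr P \o mulmx S0) \+ (mulmxr Q \o mulmx S1).
have : ~~ row_free (lin_mx PhiM).
  rewrite -row_leq_rank -ltnNge; apply: leq_ltn_trans (rank_leq_col _) _.
  case: (r) rk => // r' rk; rewrite ltnS in rk.
  apply: (@leq_ltn_trans (r'.+2 * r')); first by rewrite leq_mul2l rk orbT.
  by rewrite mulSn [X in (_ < X)%N]mulnS ltn_add2r.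
rewrite -kermx_eq0 => /rowV0Pn[x /sub_kermxP xL x0].
pose X : 'M[F]_r := vec_mx x.
have X0 : X != 0 by rewrite vec_mx_eq0.
have PhiX : Phi X = 0.
  apply: (can_inj mxvecK); rewrite linear0 -[RHS]xL -[x in RHS]vec_mxK.
  by rewrite mul_vec_lin.
pose Y := X *m U.
have Y0 : Y != 0 by rewrite mulmx_free_eq0.
pose g i := \poly_(l < r) (if insub l is Some l' then Y l' i else 0).
have gE i (l : 'I_r) : (g i)`_l = Y l i.
  by rewrite coef_poly ltn_ord valK.
have g_ge i l : (r <= l)%N -> (g i)`_l = 0.
  by rewrite coef_poly ltnNge => ->.
have S0E (G : 'M[F]_(r, n)) k j : (S0 *m G) k j =
    if insub (k : nat) is Some l then G l j else 0.
  rewrite mxE; case: insubP => [l _ lk|].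
    rewrite (bigD1 l) //= mxE -lk eqxx mul1r big1 ?addr0 // => l' nl.
    by rewrite mxE -lk eq_sym val_eqE (negbTE nl) mul0r.
  rewrite -leqNgt => rk'; rewrite big1 // => l _; rewrite mxE.
  by rewrite (gtn_eqF (leq_trans (ltn_ord l) rk')) mul0r.
have S1E (G : 'M[F]_(r, n)) k j : (S1 *m G) k j =
    if (k : nat) is l.+1 then if insub l is Some l' then G l' j else 0 else 0.
  rewrite mxE; case: k => -[|k] hk /=.
    by rewrite big1 // => l _; rewrite mxE mul0r.
  rewrite insubT (bigD1 (Ordinal (hk : (k < r)%N))) //= mxE eqxx mul1r big1 ?addr0 // => l nl.
  rewrite mxE /= eqSS; move: nl; rewrite -val_eqE /= eq_sym => /negbTE ->.
  by rewrite mul0r.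
exists g; split.
- move=> j; apply/polyP => k; rewrite coef_pencil coef0.
  have coefY (G : 'M[F]_(m, n)) l : \sum_i (g i)`_l * G i j =
      if insub l is Some l' then (Y *m G) l' j else 0.
    case: insubP => [l' _ <-|]; first by rewrite mxE; apply: eq_bigr => i _; rewrite gE.
    by rewrite -leqNgt => h; rewrite big1 // => i _; rewrite g_ge ?mul0r.
  have [k_le|k_gt] := leqP k r; last first.
    case: k k_gt => // k k_gt.
    by rewrite !coefY !insubF ?addr0 // ltnNge ?(ltnW k_gt) // -ltnS k_gt.
  have := congr1 (fun G : 'M_(r.+1, s) => (G *m E) (Ordinal (k_le : (k < r.+1)%N)) j) PhiX.
  rewrite /= mul0mx [RHS]mxE /Phi mulmxDl -!mulmxA -UA -UB !(mulmxA X) -/Y mxE S0E S1E /=.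
  by case: (k) => [|l]; rewrite !coefY //= [in RHS]mxE.
- by move=> i; apply: size_poly.
- have [l [i Yli]] : exists l i, Y l i != 0.
    apply: contrapT => h; case/eqP: Y0; apply/matrixP => l i; rewrite [RHS]mxE.
    by apply/eqP/negPn/negP => hh; apply: h; exists l, i.
  by exists i; apply: contraNneq Yli => gi; rewrite -gE gi coef0.
Qed.

(** Kronecker: a primitive vector f that spans the kernel of a pencil has
    linearly independent coefficients c_0, ..., c_d.  Let W be their span.  From
    f (A + X B) = 0 one gets c_0 A = 0 and c_(k+1) A = - c_k B, so W B lies in
    W A, and dim (W A) < dim W because c_0 <> 0.  If dim W <= d,
    [short_pencil_kernel] gives a kernel vector g of degree less than d; but f
    is primitive, so g is a polynomial multiple of f, which has degree d. *)
Lemma pencil_kernel_coefficients_free d A B f :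
  in_pencil_kernel A B f ->
  (forall g, in_pencil_kernel A B g -> forall i k, g i * f k = g k * f i) ->
  (forall i, (size (f i) <= d.+1)%N) ->
  (exists u, \sum_i u i * f i = 1) -> (exists i, (f i)`_d != 0) ->
  row_free (\matrix_(k < d.+1, i < m) (f i)`_k).
Proof.
move=> fker fgen fsize [u uf] [i0 fd].
set c := (X in row_free X).
apply/negPn/negP => nfree.
have rk : (\rank c <= d)%N.
  by rewrite -ltnS ltn_neqAle rank_leq_row andbT.
pose U := row_base c.
have U_free : row_free U by exact: row_base_free.
have [D cD] : exists D, c = D *m U by apply/submxP; rewrite eq_row_base.
have [D' UD] : exists D', U = D' *m c by apply/submxP; rewrite eq_row_base.
have ker_coef k j : \sum_i (f i)`_k * A i j
    + (if k is l.+1 then \sum_i (f i)`_l * B i j else 0) = 0.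
  by rewrite -coef_pencil fker coef0.
have [i1 f0] : exists i, (f i)`_0 != 0.
  apply: contrapT => h; move: (congr1 (fun p => p.[0]) uf).
  rewrite hornerC horner_sum big1 ?(rwP eqP) ?(eq_sym 0) ?oner_eq0 // => i _.
  rewrite hornerM !horner_coef0; have [->|fi] := eqVneq (f i)`_0 0.
    by rewrite mulr0.
  by case: h; exists i.
have rkA : (\rank (U *m A) < \rank c)%N.
  rewrite ltn_neqAle rank_leq_row andbT; apply/negP => freeA.
  have {}freeA : row_free (U *m A) by [].
  have c0 : row 0 c *m A = 0.
    apply/rowP => j; rewrite -row_mul !mxE -[RHS](ker_coef 0%N j) addr0.
    by apply: eq_bigr => i _; rewrite mxE.
  have : row 0 D *m (U *m A) = 0 by rewrite mulmxA -row_mul -cD.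
  move/eqP; rewrite mulmx_free_eq0 // => /eqP D0.
  case/eqP: f0; have : row 0 c = 0 by rewrite cD row_mul D0 mul0mx.
  by move/rowP/(_ i1); rewrite !mxE.
have cBA : (c *m B <= c *m A)%MS.
  apply/row_subP => k.
  have -> : row k (c *m B) = - \row_j (\sum_i (f i)`_k.+1 * A i j).
    apply/rowP => j; rewrite !mxE; apply/eqP; rewrite -addr_eq0 addrC.
    rewrite -[X in _ == X](ker_coef k.+1 j); apply/eqP; congr (_ + _).
    by apply: eq_bigr => i _; rewrite mxE.
  rewrite eqmx_opp.
  have [hk|hk] := ltnP k.+1 d.+1.
    rewrite (_ : \row_j _ = row (Ordinal hk) (c *m A)) ?row_sub //.
    by apply/rowP => j; rewrite !mxE; apply: eq_bigr => i _; rewrite mxE.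
  rewrite (_ : \row_j _ = 0) ?sub0mx //; apply/rowP => j; rewrite !mxE big1 // => i _.
  by rewrite nth_default ?mul0r // (leq_trans (fsize i)).
have UBA : (U *m B <= U *m A)%MS.
  rewrite [in X in (X <= _)%MS]UD -mulmxA; apply: submx_trans (submxMl _ _) _.
  apply: submx_trans cBA _; have := congr1 (mulmx^~ A) cD.
  by rewrite /= -mulmxA => ->; rewrite submxMl.
have [g [gker gsize [i2 gi2]]] := short_pencil_kernel U_free rkA UBA.
(* g_i = sum_k u_k f_k g_i = sum_k u_k g_k f_i = p f_i. *)
pose p := \sum_k u k * g k.
have gE i : g i = p * f i.
  rewrite /p mulr_suml -[LHS]mul1r -uf mulr_suml; apply: eq_bigr => k _.
  by rewrite -!mulrA; congr (_ * _); rewrite mulrC fgen.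
have p0 : p != 0 by apply: contraNneq gi2 => p0; rewrite gE p0 mul0r.
have fi0 : f i0 != 0 by apply: contraNneq fd => ->; rewrite coef0.
have sf : (d < size (f i0))%N by rewrite ltnNge; apply: contra fd => h; rewrite nth_default.
have := gsize i0; rewrite gE size_mul // leqNgt; case/negP.
apply: leq_ltn_trans rk (leq_trans sf _).
by rewrite -(prednK (_ : 0 < size p)%N) ?size_poly_gt0 // addSn leq_addl.
Qed.

Lemma combination_of_free_coefficients d f (q : {poly F}) :
  row_free (\matrix_(k < d.+1, i < m) (f i)`_k) ->
  (forall i, (size (f i) <= d.+1)%N) -> (size q <= d.+1)%N ->
  exists w : 'I_m -> F, q = \sum_i w i *: f i.
Proof.
move=> /row_freeP[V cV] fsize qsize.
pose w := V *m (\col_(k < d.+1) q`_k).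
exists (fun i => w i 0); apply/polyP => k; rewrite coef_sum.
have [hk|hk] := ltnP k d.+1; last first.
  rewrite nth_default ?(leq_trans qsize) // big1 // => i _.
  by rewrite coefZ nth_default ?mulr0 // (leq_trans (fsize i)).
transitivity ((\col_(k < d.+1) q`_k : 'cV_d.+1) (Ordinal hk) 0); first by rewrite mxE.
rewrite -[\col_k _]mul1mx -cV -mulmxA mxE; apply: eq_bigr => i _.
by rewrite coefZ mxE mulrC.
Qed.

End Pencil.

(** * Homogeneous polynomials *)

Section HomogeneousComponents.
Variables (K : fieldType) (n : nat).
Local Notation S := {mpoly K[n]}.
Implicit Types (p q f : S) (J : S -> Prop).

Lemma homog_rect (Q : S -> Prop) d p :
  Q 0 -> (forall c p q, Q p -> Q q -> Q (c *: p + q)) ->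
  (forall m, mdeg m = d -> Q 'X_[m]) -> p \is d.-homog -> Q p.
Proof.
move=> Q0 QD QX /dhomogP hp; rewrite [p]mpolyE big_seq.
by elim/big_rec: _ => // m q mp Qq; apply: QD => //; apply: QX; apply: hp.
Qed.

Lemma mdegS_split m d : mdeg m = d.+1 ->
  exists (k : 'I_n) m', m = (U_(k) + m')%MM /\ mdeg m' = d.
Proof.
move=> md; have [k mk] : exists k, (0 < m k)%N.
  apply: contrapT => h; have : mdeg m = 0%N.
    rewrite mdegE big1 // => k _; apply/eqP; rewrite -leqn0 leqNgt.
    by apply/negP => mk; apply: h; exists k.
  by rewrite md.
have E : m = (U_(k) + (m - U_(k)))%MM.
  by rewrite addmC submK //; apply/mnm_lepP => l; rewrite mnm1E; case: eqP => // <-.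
exists k, (m - U_(k))%MM; split=> //.
by apply/succn_inj; rewrite -md [in RHS]E mdegD mdeg1.
Qed.

Lemma pihomog_homogM f e k h : f \is e.-homog ->
  pihomog mdeg k (f * h) = if (e <= k)%N then f * pihomog mdeg (k - e) h else 0.
Proof.
move=> hf; rewrite [in LHS](pihomog_partitionE (leqnn (mmeasure mdeg h))).
have comp l : f * pihomog mdeg l h \is (e + l).-homog.
  by apply: dhomogM => //; apply: pihomogP.
rewrite mulr_sumr raddf_sum /=; case: leqP => [ek|ke]; last first.
  rewrite big1 // => l _; apply: pihomog_ne0 (comp l).
  by rewrite gtn_eqF // (leq_trans ke) ?leq_addr.
have [lt|ge] := ltnP (k - e) (mmeasure mdeg h).
  rewrite (bigD1 (Ordinal lt)) //= pihomog_dE; last first.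
    by rewrite -[X in X.-homog](subnKC ek).
  rewrite big1 ?addr0 // => l nl; apply: pihomog_ne0 (comp l).
  apply: contra nl => /eqP El; rewrite -val_eqE /= -El addKn //.
rewrite big1 => [|l _]; last first.
  apply: pihomog_ne0 (comp l); apply: contraTneq (ltn_ord l) => El.
  by rewrite -leqNgt; move: ge; rewrite -El addKn.
suff -> : pihomog mdeg (k - e) h = 0 by rewrite mulr0.
rewrite pihomogE big_seq_cond big1 // => m /andP[mh /eqP mk].
by move: (mmeasure_mnm_lt mdeg mh); rewrite mk ltnNge ge.
Qed.

(** The largest homogeneous ideal inside J. *)
Lemma homog_core_ideal J : is_ideal J ->
  is_ideal (fun p => forall k, J (pihomog mdeg k p)).
Proof.
move=> hJ; split=> [k|p q hp hq k|a p hp k].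
- by rewrite pihomog0; apply: is_ideal0.
- by rewrite pihomogD; apply: is_idealD.
rewrite [a](pihomog_partitionE (leqnn (mmeasure mdeg a))) mulr_suml raddf_sum.
apply: is_ideal_sum => // l _ /=; rewrite (pihomog_homogM _ _ (pihomogP _ _ _)).
by case: ifP => _; [apply: is_idealMl | apply: is_ideal0].
Qed.

Lemma homog_rmorph_eq0 (A : comNzRingType) (r : {rmorphism S -> A}) (G : S -> Prop) e p d :
  (forall g, G g -> g \is e.-homog /\ r g = 0) ->
  ideal_gen G p -> r (pihomog mdeg d p) = 0.
Proof.
move=> hG; have hker : is_ideal (fun p => r p = 0).
  split=> [|x y rx ry|a x rx]; first exact: rmorph0.
    by rewrite rmorphD rx ry addr0.
  by rewrite rmorphM rx mulr0.
move=> Gp; move: p Gp d.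
apply: (ideal_gen_le (J := fun p => forall d, r (pihomog mdeg d p) = 0)) => [|g /hG[ge rg] d].
  exact: (homog_core_ideal hker).
have [<-|ne] := eqVneq e d; first by rewrite pihomog_dE.
by rewrite (pihomog_ne0 ne ge) rmorph0.
Qed.

Lemma maxidX k : maxid ('X_k : S).
Proof. by apply: sub_ideal_gen; exists k. Qed.

Lemma monomial_maxid_pow m : ideal_pow maxid (mdeg m) ('X_[m] : S).
Proof.
move: {2}(mdeg m) (erefl (mdeg m)) => d; elim: d m => [|d IH] m md.
  by rewrite md.
have [k [m' [-> m'd]]] := mdegS_split md.
rewrite mdegD mdeg1 mpolyXD; apply: ideal_powS; first exact: maxidX.
exact: IH.
Qed.

Lemma homog_maxid_pow d p : p \is d.-homog -> ideal_pow maxid d p.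
Proof.
have hI := ideal_pow_ideal (@maxid n K) d.
apply: (homog_rect (Q := ideal_pow (@maxid n K) d)) => [|c q q' hq hq'|m <-].
- exact: is_ideal0.
- by rewrite -mul_mpolyC; apply: is_idealD => //; apply: is_idealMl.
- exact: monomial_maxid_pow.
Qed.

Lemma maxid_pow_le e J : is_ideal J -> (forall m, mdeg m = e -> J 'X_[m]) ->
  ideal_le (ideal_pow maxid e) J.
Proof.
move=> hJ JX; apply: (family_ideal_pow_le (y := fun k => 'X_k)) => // m me.
by rewrite mmap1_id; apply: JX.
Qed.

Lemma generated_in_degree_le d (I : S -> Prop) : generated_in_degree d I ->
  ideal_le I (ideal_pow maxid d).
Proof.
move=> hgen p /hgen; move: p; apply: ideal_gen_le; first exact: ideal_pow_ideal.
by move=> p [_ /homog_maxid_pow].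
Qed.

Lemma ideal_pow_maxid_le d (I : S -> Prop) t : ideal_le I (ideal_pow maxid d) ->
  ideal_le (ideal_pow I t) (ideal_pow (@maxid n K) (d * t)).
Proof.
move=> hI; elim: t => [|t IH]; first by rewrite muln0.
apply: ideal_powS_le => [|x y Ix Iy]; first exact: ideal_pow_ideal.
by rewrite mulnS; apply: ideal_powD; [apply: hI | apply: IH].
Qed.

End HomogeneousComponents.

Section HomogeneousGenerators.
Variables (K : fieldType) (n : nat).
Local Notation S := {mpoly K[n]}.

(** For the ideal generated by forms of degree d, membership of a form of degree
    d + e is witnessed by cofactors that are forms of degree e: replace each
    cofactor by its component of degree e. *)
Lemma homog_ideal_gen (G T : S -> Prop) d e p :
  (forall g, G g -> g \is d.-homog) ->
  T 0 -> (forall p q, T p -> T q -> T (p + q)) ->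
  (forall g h, G g -> h \is e.-homog -> T (g * h)) ->
  ideal_gen G p -> p \is (d + e).-homog -> T p.
Proof.
move=> hG T0 TD TM Gp hp.
suff /(_ 1) : forall a, T (pihomog mdeg (d + e) (p * a)) by rewrite mulr1 pihomog_dE.
move: p Gp {hp}.
apply: (ideal_gen_le (J := fun p => forall a, T (pihomog mdeg (d + e) (p * a)))).
  split=> [a|p q hp hq a|a p hp b].
  - by rewrite mul0r pihomog0.
  - by rewrite mulrDl pihomogD; apply: TD.
  - by rewrite mulrC mulrCA mulrC -mulrA mulrC -mulrA.
move=> g Gg a; rewrite (pihomog_homogM _ _ (hG _ Gg)) leq_addr addKn.
by apply: TM => //; apply: pihomogP.
Qed.

(** The zero terms below degree e allow the index to run over a type of monomials
    that is already finite. *)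
Lemma homog_monomialE e (p : S) : p \is e.-homog ->
  p = \sum_(m : 'X_{1..n < e.+1}) p@_m *: (if mdeg m == e then 'X_[m] else 0).
Proof.
move=> hp; rewrite [LHS](@mpolywE _ _ e.+1).
  apply: eq_bigr => m _; case: eqP => // /eqP me.
  by rewrite (dhomog_nemf_coeff hp me) !scale0r.
rewrite msizeE big_seq; elim/big_rec: _ => // m k mp hk.
by rewrite geq_max hk andbT (dhomog_mf hp mp).
Qed.

Lemma dhomog_det d r (A : 'M[S]_r) :
  (forall i j, A i j \is d.-homog) -> \det A \is (d * r).-homog.
Proof.
move=> hA; apply: rpred_sum => s _; rewrite -signr_odd; set p := \prod_i _.
suff hp : p \is (d * r).-homog.
  by case: (odd _); rewrite ?expr1 ?expr0 ?mulN1r ?mul1r ?rpredN.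
have : forall q : seq 'I_r, \prod_(i <- q) A i (s i) \is (d * size q).-homog.
  elim=> [|k q IH]; first by rewrite big_nil muln0 dhomog1.
  by rewrite big_cons mulnS dhomogM.
by move/(_ (index_enum _)); rewrite {2}/index_enum -enumT size_enum_ord.
Qed.

End HomogeneousGenerators.

Lemma meval_homog_scale (K : fieldType) n e (p : {mpoly K[n]}) a (P : 'I_n -> K) :
  p \is e.-homog -> p.@[fun k => a * P k] = a ^+ e * p.@[P].
Proof.
move=> /dhomogP hp; rewrite !mevalE big_seq [in RHS]big_seq mulr_sumr.
apply: eq_bigr => m /hp <-; rewrite mulrCA; congr (_ * _).
by rewrite /= mdegE -prodrXr -big_split; apply: eq_bigr => k _; rewrite exprMn.
Qed.

(** * Separation of points and tangent vectors along lines *)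

Section Lines.
Variables (K L : fieldType) (i : {rmorphism K -> L}) (n : nat).
Variables (a b : 'I_n -> L).
Local Notation S := {mpoly K[n]}.

Definition line (k : 'I_n) : {poly L} := (a k)%:P + b k *: 'X.

(** The restriction of a polynomial to the line through a in direction b, as a
    polynomial in the parameter. *)
Definition on_line : S -> {poly L} := mmap (polyC \o i) line.

HB.instance Definition _ := GRing.RMorphism.on on_line.

Lemma on_lineC c : on_line c%:MP = (i c)%:P.
Proof. by rewrite /on_line mmapC. Qed.

Lemma on_lineX k : on_line 'X_k = line k.
Proof. by rewrite /on_line mmapX mmap1U. Qed.

Lemma on_lineZ c p : on_line (c *: p) = i c *: on_line p.
Proof. by rewrite -mul_mpolyC rmorphM /= on_lineC mul_polyC. Qed.

Lemma horner_on_line p z : (on_line p).[z] = mmap i (fun k => a k + z * b k) p.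
Proof.
rewrite /on_line /mmap horner_sum; apply: eq_bigr => m _.
rewrite hornerM hornerC horner_prod; congr (_ * _); apply: eq_bigr => k _.
by rewrite horner_exp hornerD hornerC hornerZ hornerX mulrC.
Qed.

(** The top coefficient is the value at the point at infinity b of the line. *)
Lemma size_coef_on_line p d : p \is d.-homog ->
  (size (on_line p) <= d.+1)%N /\ (on_line p)`_d = mmap i b p.
Proof.
pose T e (q : {poly L}) c := (size q <= e.+1)%N /\ q`_e = c.
have TM e q c e' q' c' : T e q c -> T e' q' c' -> T (e + e')%N (q * q') (c * c').
  move=> [sq qe] [sq' qe']; split.
    apply: leq_trans (size_polyMleq _ _) _.
    by rewrite -subn1 leq_subLR add1n -addSn -addnS leq_add.
  have he : (e < (e + e').+1)%N by rewrite ltnS leq_addr.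
  rewrite coefM (bigD1 (Ordinal he)) //= addKn qe qe' big1 ?addr0 // => -[j hj].
  rewrite -val_eqE /= neq_ltn => /orP[ltj|ltj].
    rewrite [q'`__]nth_default ?mulr0 //; apply: leq_trans sq' _.
    by rewrite ltn_subRL addnC [X in (_ < X)%N]addnC ltn_add2l.
  by rewrite nth_default ?mul0r //; apply: leq_trans ltj.
have TX e q c k : T e q c -> T (e * k)%N (q ^+ k) (c ^+ k).
  move=> h; elim: k => [|k IH].
    by rewrite muln0 !expr0; split; rewrite ?size_poly1 // coef1.
  by rewrite mulnS !exprS; apply: TM.
have Tm m : T (mdeg m) (mmap1 line m) (mmap1 b m).
  rewrite mdegE /mmap1; elim/big_rec3: _ => [|k c q e _ h].
    by split; rewrite ?size_poly1 // coef1.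
  apply: TM h; have := @TX 1%N (line k) (b k) (m k); rewrite mul1n; apply; split.
    apply: leq_trans (size_polyD _ _) _; rewrite geq_max.
    rewrite (leq_trans (size_polyC_leq1 _)) //=.
    by apply: leq_trans (size_scale_leq _ _) _; rewrite size_polyX.
  by rewrite coefD coefC add0r coefZ coefX mulr1.
move=> /dhomogP hp; rewrite /on_line /mmap; split.
  rewrite big_seq; elim/big_rec: _ => [|m q mp hq]; first by rewrite size_poly0.
  apply: leq_trans (size_polyD _ _) _; rewrite geq_max hq andbT mul_polyC.
  by apply: leq_trans (size_scale_leq _ _) _; rewrite -(hp _ mp); case: (Tm m).
rewrite coef_sum big_seq [RHS]big_seq; apply: eq_bigr => m mp.
by rewrite coefCM -(hp _ mp); case: (Tm m) => _ ->.
Qed.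

End Lines.

Section Separation.
Variables (K : fieldType) (n : nat).
Local Notation S := {mpoly K[n]}.

Definition independent_points (L : fieldType) (a b : 'I_n -> L) : Prop :=
  exists k l, a k * b l != a l * b k.

(** The restrictions to a line only have to reach the single polynomial X: this
    gives at once a form that separates a from a + b and one that is not
    singular at a in the direction b. *)
Definition separates_on_lines (V : S -> Prop) : Prop :=
  forall (L : fieldType) (i : {rmorphism K -> L}) (a b : 'I_n -> L),
  finite_extension i -> independent_points a b ->
  exists m (c : 'I_m -> L) (v : 'I_m -> S),
    (forall j, V (v j)) /\ \sum_j c j *: on_line i a b (v j) = 'X.

Lemma line_combination (L : fieldType) (a b : 'I_n -> L) :
  independent_points a b ->
  exists k l (x y : L), x *: line a b k + y *: line a b l = 1.
Proof.
move=> [k [l kl]]; have D0 : a k * b l - a l * b k != 0 by rewrite subr_eq0.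
set D := _ - _ in D0; exists k, l, (b l / D), (- b k / D).
rewrite /line !scalerDr addrACA !scalerA -scalerDl -!mul_polyC -!polyCM -polyCD.
rewrite (_ : b l / D * b k + - b k / D * b l = 0); last first.
  by rewrite mulNr mulNr mulrAC [in X in _ - X]mulrAC [b k * b l]mulrC subrr.
rewrite (_ : b l / D * a k + - b k / D * a l = 1) ?mul0r ?addr0 //.
rewrite mulNr mulNr mulrAC [in X in _ - X]mulrAC -mulrBl.
by rewrite [b l * _]mulrC [b k * _]mulrC mulfV.
Qed.

(** The pencil is the transpose of the restriction of phi to the line; its
    constant and linear coefficients suffice as the entries of phi are linear
    forms.  Exactness of the presentation enters through the Koszul syzygies,
    which can be restricted to a line over any field.  The restricted
    generators are primitive since the ideal they generate contains powers of
    the restrictions of all variables, hence, as a and b are independent, 1 in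
    its radical. *)
Lemma linearly_presented_separates d (I : S -> Prop) : (0 < d)%N ->
  is_ideal I -> (forall k, radical I 'X_k) -> linearly_presented d I ->
  separates_on_lines (fun p => I p /\ p \is d.-homog).
Proof.
move=> d0 hI hrad [n1 [n0 [phi [f [phi_deg f_deg fI fphi _]]]]] L i a b _ ab.
pose r : {rmorphism S -> {poly L}} := on_line i a b.
pose F k := r (f k 0).
pose A := \matrix_(k, j) (r (phi j k))`_0.
pose B := \matrix_(k, j) (r (phi j k))`_1.
(* The entries of phi are forms of degree (d + 1) - d = 1. *)
have phiE j k : (A k j)%:P + (B k j)%:P * 'X = r (phi j k).
  have : phi j k \is 1.-homog.
    by have := phi_deg j k; rewrite /shifted_homog leqnSn subSnn.
  move=> /(size_coef_on_line i a b)[sz _].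
  apply/polyP => l; rewrite coefD coefC coefMX coefC !mxE.
  case: l => [|[|l]] /=; rewrite ?addr0 ?add0r //.
  by rewrite nth_default // (leq_trans sz).
have rmulmx p (u : 'M[S]_(p, n1)) (v : 'M[S]_(n1, n0)) x y :
    r ((u *m v) x y) = \sum_j r (u x j) * r (v j y).
  by rewrite mxE rmorph_sum; apply: eq_bigr => j _; rewrite rmorphM.
have Fker : in_pencil_kernel A B F.
  move=> j; have /fphi : exists v : 'rV_n1, row j phi = v *m phi.
    by exists (delta_mx 0 j); rewrite -rowE.
  move/matrixP/(_ 0 0)/(congr1 r); rewrite [in RHS]mxE rmorph0 => {2}<-.
  rewrite mxE rmorph_sum; apply: eq_bigr => k _.
  by rewrite phiE mxE rmorphM mulrC.
have Fgen g : in_pencil_kernel A B g -> forall x y, g x * F y = g y * F x.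
  move=> gker x y.
  pose u : 'rV[S]_n0 := f y 0 *: delta_mx 0 x - f x 0 *: delta_mx 0 y.
  have uf : u *m f = 0.
    rewrite mulmxBl -!scalemxAl -!rowE; apply/matrixP => p q.
    by rewrite !ord1 !mxE mulrC subrr.
  have /fphi[v uv] := uf.
  have : \sum_k r (u 0 k) * g k = 0.
    transitivity (\sum_j r (v 0 j) * \sum_k g k * r (phi j k)).
      under eq_bigr do rewrite uv rmulmx mulr_suml.
      rewrite exchange_big; apply: eq_bigr => j _; rewrite mulr_sumr.
      by apply: eq_bigr => k _; rewrite -mulrA [r (phi _ _) * _]mulrC.
    rewrite big1 // => j _; rewrite (_ : \sum_k _ = 0) ?mulr0 //.
    by rewrite -[RHS](gker j); apply: eq_bigr => k _; rewrite phiE.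
  under eq_bigr do rewrite !mxE rmorphB !rmorphM mulrBl !eqxx /=.
  rewrite sumrB (bigD1 x) //= eqxx rmorph1 mulr1 big1 ?addr0; last first.
    by move=> k /negbTE ->; rewrite rmorph0 mulr0 mul0r.
  rewrite (bigD1 y) //= eqxx rmorph1 mulr1 big1 ?addr0; last first.
    by move=> k /negbTE ->; rewrite rmorph0 mulr0 mul0r.
  by move/eqP; rewrite subr_eq0 => /eqP; rewrite mulrC [RHS]mulrC.
have Fsize k : (size (F k) <= d.+1)%N.
  by case: (size_coef_on_line i a b (f_deg k)).
pose J (q : {poly L}) := exists u, \sum_k u k * F k = q.
have hJ : is_ideal J.
  split=> [|x y [u <-] [v <-]|c x [u <-]].
  - by exists (fun=> 0); rewrite big1 // => k _; rewrite mul0r.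
  - exists (fun k => u k + v k); rewrite -big_split /=.
    by apply: eq_bigr => k _; rewrite mulrDl.
  - exists (fun k => c * u k); rewrite mulr_sumr.
    by apply: eq_bigr => k _; rewrite mulrA.
have JI p : I p -> J (r p).
  move=> /fI[u ->]; exists (fun k => r (u 0 k)).
  by rewrite mxE rmorph_sum; apply: eq_bigr => k _; rewrite rmorphM.
have Jline k : radical J (line a b k).
  by have [N /JI] := hrad k; rewrite rmorphXn /r /= on_lineX; exists N.
have J1 : J 1.
  have [k [l [x [y E]]]] := line_combination ab.
  have : radical J 1.
    rewrite -E; apply: (is_idealD (radical_ideal hJ)); rewrite -mul_polyC;
    exact: (is_idealMl _ (radical_ideal hJ)).
  by move=> [N]; rewrite expr1n.
have Fd : exists k, (F k)`_d != 0.
  apply: contrapT => h.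
  have F0 p : I p -> mmap i b p = 0.
    move=> /fI[u ->]; rewrite mxE rmorph_sum big1 // => k _; rewrite rmorphM /=.
    have <- : (F k)`_d = mmap i b (f k 0).
      by case: (size_coef_on_line i a b (f_deg k)).
    by have [->|fk] := eqVneq (F k)`_d 0; [rewrite mulr0|case: h; exists k].
  have b0 k : b k = 0.
    have [N /F0] := hrad k; rewrite rmorphXn /= mmapX mmap1U => /eqP.
    by rewrite expf_eq0 => /andP[_ /eqP].
  by case: ab => k [l]; rewrite !b0 !mulr0 eqxx.
have Ffree := pencil_kernel_coefficients_free Fker Fgen Fsize J1 Fd.
have [|w wX] := combination_of_free_coefficients (q := 'X) Ffree Fsize.
  by rewrite size_polyX.
exists n0, w, (fun k => f k 0); split=> // k; split=> //.
by apply/fI; exists (delta_mx 0 k); rewrite -rowE mxE.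
Qed.

(** The linear forms [al] and [be] are dual to a and b, so that they restrict to 1
    and X on the line; the forms Z_k = X_k - a_k al - b_k be vanish on it, and
    for k different from the two indices used in [al] and [be] they are
    independent.  The form al^(d-1) be restricts to X and agrees with an element
    of I modulo these Z_k. *)
Lemma closed_separates d (I : S -> Prop) : (0 < d)%N ->
  is_ideal I -> homogeneous_ideal I -> GRing.closed_field_axiom K ->
  (forall z : 'I_(n - 2) -> S, independent_linear_forms z ->
     ideal_le (ideal_pow maxid d)
       (ideal_add I (ideal_gen (fun p => exists j, p = z j)))) ->
  separates_on_lines (fun p => I p /\ p \is d.-homog).
Proof.
move=> d0 hI hhom hK hz L i a' b' iF ab.
have /fin_all_exists[a Ea] : forall k, exists y, a' k = i y.
  by move=> k; apply: closed_field_extension.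
have /fin_all_exists[b Eb] : forall k, exists y, b' k = i y.
  by move=> k; apply: closed_field_extension.
have [k0 [l0]] := ab; rewrite !Ea !Eb -!rmorphM (inj_eq (fmorph_inj i)) => kl.
set D := a k0 * b l0 - a l0 * b k0; have D0 : D != 0 by rewrite subr_eq0.
pose al : S := D^-1 *: (b l0 *: 'X_k0 - b k0 *: 'X_l0).
pose be : S := D^-1 *: (a k0 *: 'X_l0 - a l0 *: 'X_k0).
pose Z k : S := 'X_k - a k *: al - b k *: be.
pose r : {rmorphism S -> {poly L}} := on_line i a' b'.
have rX k : r 'X_k = (i (a k))%:P + i (b k) *: 'X.
  by rewrite /r /= on_lineX /line Ea Eb.
have rZ c p : r (c *: p) = i c *: r p by rewrite /r /= on_lineZ.
have rD : (i D^-1)%:P * ((i (a k0))%:P * (i (b l0))%:P - (i (a l0))%:P * (i (b k0))%:P) = 1.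
  by rewrite -!polyCM -polyCB -polyCM -!rmorphM -rmorphB -rmorphM mulVf // rmorph1.
have ral : r al = 1.
  by rewrite rZ rmorphB !rZ !rX -!mul_polyC -rD; ring.
have rbe : r be = 'X.
  by rewrite rZ rmorphB !rZ !rX -!mul_polyC -[RHS]mul1r -rD; ring.
have rZ0 k : r (Z k) = 0.
  rewrite !rmorphB (rZ (a k)) (rZ (b k)) ral rbe rX alg_polyC [X in X - _]addrAC subrr add0r.
  by rewrite subrr.
have X1 k : ('X_k : S) \is 1.-homog by rewrite dhomogX /= mdeg1.
have al1 : al \is 1.-homog by rewrite rpredZ // rpredB ?rpredZ.
have be1 : be \is 1.-homog by rewrite rpredZ // rpredB ?rpredZ.
have Z1 k : Z k \is 1.-homog.
  by apply: rpredB; [apply: rpredB => //|]; apply: rpredZ.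
have nkl : k0 != l0 by apply: contraNneq kl => ->.
pose s := [seq k <- enum 'I_n | (k != k0) && (k != l0)].
have us : uniq s by rewrite filter_uniq ?enum_uniq.
have ss : size s = (n - 2)%N.
  have /card_uniqP <- := us; rewrite (eq_card (B := [predC pred2 k0 l0])); last first.
    by move=> k; rewrite !inE mem_filter mem_enum andbT negb_or.
  have := cardC (pred2 k0 l0); rewrite card_ord card2 nkl.
  by move=> /(congr1 (subn^~ 2)) /= <-; rewrite addKn.
pose z (j : 'I_(n - 2)) := Z (nth k0 s j).
have zI : independent_linear_forms z.
  split=> [j|c c0 j]; first exact: Z1.
  have js : (j < size s)%N by rewrite ss.
  have /andP[nk nl] : (nth k0 s j != k0) && (nth k0 s j != l0).
    by have := mem_nth k0 js; rewrite mem_filter => /andP[].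
  have := congr1 (mcoeff U_(nth k0 s j)) c0; rewrite mcoeff0 raddf_sum /=.
  rewrite (bigD1 j) //= big1 ?addr0 => [|j' nj].
    rewrite /z /Z /al /be !(mcoeffZ, mcoeffB, mcoeffXU) eqxx ![_ == nth _ _ _]eq_sym.
    by rewrite (negbTE nk) (negbTE nl) !(mulr0, subr0, oppr0) mulr1.
  rewrite /z /Z /al /be !(mcoeffZ, mcoeffB, mcoeffXU) ![k0 == _]eq_sym ![l0 == _]eq_sym.
  rewrite (negbTE nk) (negbTE nl) nth_uniq ?ss // val_eqE (negbTE nj).
  by rewrite !(mulr0, subr0, oppr0).
have hom : al ^+ d.-1 * be \is d.-homog.
  by rewrite -[X in X.-homog](prednK d0) -addn1; apply: dhomogM => //;
     rewrite -[X in X.-homog]mul1n; apply: dhomogMn.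
have [v [w [Iv zw E]]] := hz z zI _ (homog_maxid_pow hom).
exists 1%N, (fun=> 1), (fun=> pihomog mdeg d v); split=> [_|].
  by split; [apply: hhom | apply: pihomogP].
(* The component of degree d is taken because v need not be homogeneous. *)
rewrite big_ord1 scale1r -[on_line _ _ _ _]/(r _).
transitivity (r (al ^+ d.-1 * be)).
  rewrite -[in RHS](pihomog_dE hom) E raddfD rmorphD /=.
  rewrite (homog_rmorph_eq0 (r := r) (e := 1%N) d _ zw) ?addr0 // => g [j ->].
  by split; [apply: Z1 | apply: rZ0].
by rewrite rmorphM rmorphXn ral rbe expr1n mul1r.
Qed.

End Separation.

Lemma separates_on_lines_map (K L : fieldType) (i : {rmorphism K -> L}) n
    (V : {mpoly K[n]} -> Prop) (W : {mpoly L[n]} -> Prop) :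
  finite_extension i -> (forall v, V v -> W (map_mpoly i v)) ->
  separates_on_lines V -> separates_on_lines W.
Proof.
move=> iF VW hV F j a b jF ab.
have [m [c [v [Vv E]]]] := hV F (j \o i) a b (finite_extension_comp iF jF) ab.
exists m, c, (fun k => map_mpoly i (v k)); split=> [k|]; first exact: VW.
rewrite -E; apply: eq_bigr => k _; congr (_ *: _).
by rewrite /on_line (mmap_map_mpoly i (polyC \o j)).
Qed.

(** * The local statement at a rational point *)

Section Local.
Variables (K : fieldType) (n d' : nat).
Local Notation S := {mpoly K[n]}.
Local Notation d := d'.+1.
Variables (V : S -> Prop) (P : 'I_n -> K) (i0 : 'I_n) (f0 : S).
Hypotheses (V_homog : forall v, V v -> v \is d.-homog)
  (V0 : V 0) (VD : forall c v w, V v -> V w -> V (c *: v + w))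
  (V_sep : separates_on_lines V) (Pi0 : P i0 = 1) (Vf0 : V f0) (f0P : f0.@[P] != 0).

Let u : S := 'X_i0.
Let y k : S := 'X_k - P k *: 'X_i0.
Let M := family_ideal y.
Let VP v := V v /\ v.@[P] = 0.
Let Q := ideal_gen VP.

Let idM j : is_ideal (ideal_pow M j). Proof. exact: ideal_pow_ideal. Qed.
Let idQ : is_ideal Q. Proof. exact: ideal_gen_ideal. Qed.
Let My k : M (y k). Proof. by apply: sub_ideal_gen; exists k. Qed.

Let V_sum m (c : 'I_m -> K) (v : 'I_m -> S) :
  (forall j, V (v j)) -> V (\sum_j c j *: v j).
Proof.
by move=> Vv; elim/big_rec: _ => // j w _ Vw; apply: VD.
Qed.

Lemma VP_lin c v w : VP v -> VP w -> VP (c *: v + w).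
Proof.
move=> [Vv vP] [Vw wP]; split; first exact: VD.
by rewrite mevalD mevalZ vP wP mulr0 addr0.
Qed.

Lemma VP0 : VP 0.
Proof. by split; rewrite ?meval0. Qed.

(** Subtracting a multiple of f0 corrects the value at P. *)
Lemma VP_sub v : V v -> VP (v - (v.@[P] / f0.@[P]) *: f0).
Proof.
move=> Vv; split.
  by rewrite addrC -scaleNr; apply: VD.
by rewrite mevalB mevalZ divfK // subrr.
Qed.

(** Taylor expansion at P, with u as the homogenizing coordinate and the y_k as
    local coordinates. *)
Lemma first_order_expansion e (p : S) : p \is e.+1.-homog ->
  exists c : 'rV[K]_n,
    ideal_pow M 2 (p - p.@[P] *: u ^+ e.+1 - \sum_k c 0 k *: (u ^+ e * y k)).
Proof.
apply: (homog_rect (Q := fun p : S => exists c : 'rV[K]_n,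
    ideal_pow M 2 (p - p.@[P] *: u ^+ e.+1 - \sum_k c 0 k *: (u ^+ e * y k)))).
- exists 0; rewrite meval0 scale0r subr0 sub0r big1 ?oppr0 => [|k _]; last by rewrite mxE scale0r.
  exact: is_ideal0.
- move=> a p1 p2 [c1 h1] [c2 h2]; exists (a *: c1 + c2).
  have -> : \sum_k (a *: c1 + c2) 0 k *: (u ^+ e * y k)
     = a *: (\sum_k c1 0 k *: (u ^+ e * y k)) + \sum_k c2 0 k *: (u ^+ e * y k).
    rewrite scaler_sumr -big_split; apply: eq_bigr => k _.
    by rewrite !mxE scalerDl scalerA.
  rewrite mevalD mevalZ; set s1 := \sum_k _ in h1 *; set s2 := \sum_k _ in h2 *.
  have := is_idealD (idM 2) (is_idealMl a%:MP (idM 2) h1) h2; congr (ideal_pow M 2 _).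
  by rewrite -!mul_mpolyC !mpolyCD !mpolyCM; ring.
elim: e => [|e IH] m md; have [k [m' [-> m'd]]] := mdegS_split md.
  have -> : m' = 0%MM by apply/eqP; rewrite -mdeg_eq0 m'd.
  exists (delta_mx 0 k); rewrite addm0 mevalXU (bigD1 k) //= mxE !eqxx scale1r expr1 expr0 mul1r.
  rewrite big1 ?addr0 => [|l /negbTE nl]; last by rewrite mxE nl scale0r.
  by rewrite subrr; exact: (is_ideal0 (idM 2)).
have [c h] := IH m' m'd; rewrite mpolyXD mevalM mevalXU; set w := 'X_[m'] in h *.
exists (w.@[P] *: delta_mx 0 k + P k *: c).
have -> : \sum_l (w.@[P] *: delta_mx 0 k + P k *: c) 0 l *: (u ^+ e.+1 * y l)
    = w.@[P] *: (u ^+ e.+1 * y k) + P k *: (u * \sum_l c 0 l *: (u ^+ e * y l)).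
  have -> : w.@[P] *: (u ^+ e.+1 * y k) =
      \sum_l (w.@[P] * (delta_mx 0 k : 'rV[K]_n) 0 l) *: (u ^+ e.+1 * y l).
    rewrite (bigD1 k) //= mxE !eqxx mulr1 big1 ?addr0 // => l /negbTE nl.
    by rewrite mxE nl mulr0 scale0r.
  rewrite mulr_sumr scaler_sumr -big_split; apply: eq_bigr => l _.
  by rewrite !mxE scalerDl -scalerAr !scalerA exprS mulrA.
set s := \sum_l _ in h *.
have Ms : ideal_pow M 2 (y k * s).
  rewrite mulr_sumr; apply: is_ideal_sum => // l _.
  rewrite -scalerAr -mul_mpolyC; apply: (is_idealMl _ (idM 2)).
  rewrite mulrCA; apply: (is_idealMl _ (idM 2)).
  by apply: ideal_powS => //; apply: ideal_pow1.
have := is_idealD (idM 2) Ms (is_idealMl 'X_k (idM 2) h); congr (ideal_pow M 2 _).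
rewrite /y -/u -!mul_mpolyC mpolyCM !exprS; ring.
Qed.

Section OnLine.
Variable b : 'I_n -> K.
Hypothesis bi0 : b i0 = 0.
Let r : {rmorphism S -> {poly K}} := on_line idfun P b.

Let ru : r u = 1.
Proof. by rewrite /r /= on_lineX /line Pi0 bi0 scale0r addr0. Qed.

Let ry k : r (y k) = b k *: 'X.
Proof.
rewrite /r rmorphB /= on_lineZ !on_lineX /line Pi0 bi0 scale0r addr0 alg_polyC.
by rewrite addrAC subrr add0r.
Qed.

Let rM q : M q -> exists s, r q = s * 'X.
Proof.
move: q; apply: (ideal_gen_le (J := fun q => exists s, r q = s * 'X)).
  split=> [|q q' [s E] [s' E']|a q [s E]].
  - by exists 0; rewrite rmorph0 mul0r.
  - by exists (s + s'); rewrite rmorphD E E' mulrDl.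
  - by exists (r a * s); rewrite rmorphM E mulrA.
by move=> _ [k ->]; exists (b k)%:P; rewrite ry mul_polyC.
Qed.

Let rM2 q : ideal_pow M 2 q -> (r q)`_1 = 0.
Proof.
move=> Mq; suff [s ->] : exists s, r q = s * 'X^2 by rewrite coefMXn.
move: q Mq; apply: (ideal_powS_le (J := fun q => exists s, r q = s * 'X^2)).
  split=> [|q q' [s E] [s' E']|a q [s E]].
  - by exists 0; rewrite rmorph0 mul0r.
  - by exists (s + s'); rewrite rmorphD E E' mulrDl.
  - by exists (r a * s); rewrite rmorphM E mulrA.
move=> q q' /rM[s E] Mq'.
have : M q'.
  move: q' Mq'; apply: ideal_powS_le => [|x z Mx _]; first exact: ideal_gen_ideal.
  exact: (is_idealMr _ (ideal_gen_ideal _) Mx).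
by move=> /rM[s' E']; exists (s * s'); rewrite rmorphM E E' mulrACA.
Qed.

Lemma coef1_on_line (p : S) (c : 'rV[K]_n) e :
  ideal_pow M 2 (p - p.@[P] *: u ^+ e.+1 - \sum_k c 0 k *: (u ^+ e * y k)) ->
  (r p)`_1 = \sum_k c 0 k * b k.
Proof.
move=> /rM2; rewrite !rmorphB !coefB => /eqP; rewrite subr_eq0 => /eqP h.
have rZ a q : r (a *: q) = a *: r q by rewrite /r /= on_lineZ.
move: h; rewrite rZ rmorphXn ru expr1n coefZ coef1 mulr0 subr0 => ->.
rewrite rmorph_sum coef_sum; apply: eq_bigr => k _.
by rewrite rZ rmorphM rmorphXn ru expr1n mul1r ry !coefZ coefX mulr1.
Qed.

End OnLine.

(** Every tangent covector at P comes from V: if the linear parts of the forms in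
    V_P did not span everything, a nonzero direction b would be killed by all of
    them, and the restriction of V_P to the line P + t b would have no linear
    term, against separation along this line. *)
Lemma tangent_forms k : exists2 h, VP h & ideal_pow M 2 (h - u ^+ d' * y k).
Proof.
pose U (c : 'rV[K]_n) :=
  exists2 h, VP h & ideal_pow M 2 (h - \sum_l c 0 l *: (u ^+ d' * y l)).
have U0 : U 0.
  exists 0; first exact: VP0.
  rewrite big1 ?subr0 => [|l _]; last by rewrite mxE scale0r.
  exact: (is_ideal0 (idM 2)).
have UD a c c' : U c -> U c' -> U (a *: c + c').
  move=> [h Vh hM] [h' Vh' hM']; exists (a *: h + h'); first exact: VP_lin.
  have -> : \sum_l (a *: c + c') 0 l *: (u ^+ d' * y l)
     = a *: (\sum_l c 0 l *: (u ^+ d' * y l)) + \sum_l c' 0 l *: (u ^+ d' * y l).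
    rewrite scaler_sumr -big_split; apply: eq_bigr => l _.
    by rewrite !mxE scalerDl scalerA.
  rewrite opprD addrACA -scalerBr -mul_mpolyC.
  exact: (is_idealD (idM 2) (is_idealMl _ (idM 2) hM) hM').
have deltaE l : \sum_j (delta_mx 0 l : 'rV[K]_n) 0 j *: (u ^+ d' * y j) = u ^+ d' * y l.
  rewrite (bigD1 l) //= mxE !eqxx scale1r big1 ?addr0 // => j /negbTE nj.
  by rewrite mxE nj scale0r.
suff [h Vh hM] : U (delta_mx 0 k) by exists h; rewrite // -deltaE.
have [A AU] := row_subspace U0 UD; apply/AU; rewrite submxE.
apply: contraT => nA.
have [j nj] : exists j, ((delta_mx 0 k : 'rV[K]_n) *m cokermx A) 0 j != 0.
  apply: contrapT => h; case/negP: nA; apply/eqP; apply/rowP => j; rewrite [RHS]mxE.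
  by apply/eqP/negPn/negP => hj; apply: h; exists j.
pose b l := cokermx A l j.
have Ub c : U c -> \sum_l c 0 l * b l = 0.
  by move/AU; rewrite submxE => /eqP/rowP/(_ j); rewrite !mxE.
have sdelta l : \sum_m (delta_mx 0 l : 'rV[K]_n) 0 m * b m = b l.
  rewrite (bigD1 l) //= mxE !eqxx mul1r big1 ?addr0 // => m /negbTE nm.
  by rewrite mxE nm mul0r.
(* The covector y_(i0) is zero, so it is attained; hence b is not proportional
   to P. *)
have bi0 : b i0 = 0.
  rewrite -sdelta; apply: Ub; exists 0; first exact: VP0.
  rewrite deltaE /y Pi0 scale1r subrr mulr0 subr0; exact: (is_ideal0 (idM 2)).
have bk : b k != 0 by move: nj; rewrite mxE sdelta.
have ind : independent_points P b.
  by exists i0, k; rewrite Pi0 mul1r bi0 mulr0.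
have [m [c [v [Vv E]]]] := V_sep (finite_extension_id K) ind.
pose w := \sum_j c j *: v j.
have Vw : V w by apply: V_sum.
have rw : on_line idfun P b w = 'X.
  by rewrite -E rmorph_sum; apply: eq_bigr => l _; rewrite /= on_lineZ.
have wP : w.@[P] = 0.
  have := horner_on_line idfun P b w 0; rewrite rw hornerX => ->.
  by apply: eq_bigr => q _; congr (_ * _); apply: mmap1_eq => l; rewrite mul0r addr0.
have [a ha] := first_order_expansion (V_homog Vw).
have Ua : U a by exists w => //; move: ha; rewrite wP scale0r subr0.
have := coef1_on_line bi0 ha; rewrite /= rw coefX (Ub _ Ua) => /eqP.
by rewrite oner_eq0.
Qed.

(** The forms in V_P have no common zero besides P: a zero xi with y_k(xi) <> 0
    would be a point different from P, and separation on the line that joins P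
    to xi gives a combination of V that vanishes at P but not at xi. *)
Lemma transverse_radical k : radical Q (y k).
Proof.
apply: contrapT => /forallNP hk.
have [L [i [xi [iF xi0 xik]]]] := nullstellensatz idQ hk.
pose a k := i (P k); pose b k := xi k - a k.
have ind : independent_points a b.
  exists i0, k; rewrite /b /a Pi0 rmorph1 -subr_eq0.
  move: xik; rewrite rmorphB -mul_mpolyC rmorphM /= mmapC !mmapX !mmap1U.
  by congr (_ != 0); ring.
have [m [c [v [Vv E]]]] := V_sep iF ind.
have E1 : \sum_j c j * mmap i xi (v j) = 1.
  have := congr1 (fun p => p.[1]) E; rewrite hornerX horner_sum => <-.
  apply: eq_bigr => j _; rewrite hornerZ horner_on_line; congr (_ * _).
  by apply: eq_bigr => q _; congr (_ * _); apply: mmap1_eq => l; rewrite mul1r addrC subrK.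
have E0 : \sum_j c j * i (v j).@[P] = 0.
  have := congr1 (fun p => p.[0]) E; rewrite hornerX horner_sum => h; rewrite -[RHS]h.
  apply: eq_bigr => j _; rewrite hornerZ horner_on_line; congr (_ * _).
  rewrite rmorph_sum; apply: eq_bigr => q _; rewrite rmorphM rmorph_prod.
  by congr (_ * _); apply: eq_bigr => l _; rewrite mul0r addr0 rmorphXn.
have xiC z : mmap i xi (z%:MP : S) = i z by exact: mmapC.
(* All forms in V_P vanish at xi, so on V the value at xi is a fixed multiple of
   the value at P. *)
have vxi j : mmap i xi (v j) = i (v j).@[P] * (mmap i xi f0 / i f0.@[P]).
  have := xi0 _ (sub_ideal_gen (VP_sub (Vv j))).
  rewrite rmorphB -mul_mpolyC rmorphM /= xiC => /eqP; rewrite subr_eq0 => /eqP ->.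
  by rewrite fmorph_div mulrAC -mulrA.
move: E1; under eq_bigr do rewrite vxi mulrA.
by rewrite -mulr_suml E0 mul0r => /eqP; rewrite eq_sym oner_eq0.
Qed.

(** Let C be the colon ideal of all w with y_k w in Q for every k.  By
    [transverse_radical] a power of M lies in Q, which puts a power of each y_k
    in C.  By [tangent_forms] multiplication by u^d' moves M^(s+1) into
    Q + M^(s+2), so iterating, a power of u lies in C as well.  The u and y_k
    generate m, so C contains all monomials of large degree.  A form p with
    p(P) = 0 lies in M, so p = sum_k y_k w_k with w_k forms of large degree,
    which belong to C. *)
Lemma vanishing_forms_generated : exists N, forall e (p : S),
  (N <= e)%N -> p \is e.-homog -> p.@[P] = 0 -> Q p.
Proof.
have [t ht] := monomial_in_radical idQ transverse_radical.
have MQ : ideal_le (ideal_pow M t.+1) Q.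
  by apply: family_ideal_pow_le => // m mt; apply: ht; rewrite mt.
have uQ s k : ideal_add Q (ideal_pow M s.+1) (u ^+ (d' * s) * y k).
  have idA j := ideal_add_ideal idQ (idM j).
  elim: s k => [|s IH] k.
    rewrite muln0 expr0 mul1r; apply: (ideal_addr idQ).
    exact: (ideal_pow1 (My k)).
  have [q [z [Qq Mz E]]] := IH k.
  rewrite mulnS exprD -mulrA E mulrDr; apply: (is_idealD (idA _)).
    exact: (ideal_addl (idM _) (is_idealMl _ idQ Qq)).
  move: z Mz {E}.
  apply: (ideal_powS_le (J := fun z => ideal_add Q (ideal_pow M s.+2) (u ^+ d' * z))).
    exact: colon_ideal.
  move=> x w Mx Mw; rewrite mulrA mulrC mulrA mulrC.
  move: x Mx.
  apply: (ideal_gen_le (J := fun x => ideal_add Q (ideal_pow M s.+2) (x * (w * u ^+ d')))).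
    split=> [|x x' hx hx'|a x hx]; first by rewrite mul0r; apply: (is_ideal0 (idA _)).
      by rewrite mulrDl; apply: (is_idealD (idA _)).
    by rewrite -mulrA; apply: (is_idealMl _ (idA _)).
  move=> _ [l ->]; have [h Vh hM] := tangent_forms l.
  rewrite (_ : y l * (w * u ^+ d') = w * h - (h - u ^+ d' * y l) * w); last by ring.
  apply: (is_idealB (idA _)).
    exact: (ideal_addl (idM _) (is_idealMl _ idQ (sub_ideal_gen Vh))).
  exact: (ideal_addr idQ (@ideal_powD _ M 2 s _ _ hM Mw)).
pose C w := forall k, Q (y k * w).
have idC : is_ideal C.
  split=> [k|x z hx hz k|a x hx k].
  - exact: (is_ideal0 (colon_ideal (y k) idQ)).
  - exact: (is_idealD (colon_ideal (y k) idQ)).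
  - exact: (is_idealMl _ (colon_ideal (y k) idQ)).
have Cu : radical C u.
  exists (d' * t)%N => k; rewrite mulrC.
  have [q [z [Qq /MQ Qz ->]]] := uQ t k; exact: (is_idealD idQ Qq Qz).
have Cy k : radical C (y k).
  exists t => l; apply: MQ; apply: ideal_powS => //; exact: ideal_powX.
have CX k : radical C 'X_k.
  have -> : 'X_k = y k + (P k)%:MP * u by rewrite mul_mpolyC subrK.
  apply: (is_idealD (radical_ideal idC)) => //.
  exact: (is_idealMl _ (radical_ideal idC)).
have [N hN] := monomial_in_radical idC CX.
exists N.+2 => e p Ne hp pP.
have e_gt0 : (0 < e)%N by apply: leq_trans Ne.
have idM1 : is_ideal M by apply: ideal_gen_ideal.
have Mp : M p.
  suff : M (p - p.@[P] *: u ^+ e) by rewrite pP scale0r subr0.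
  apply: (homog_rect (Q := fun p : S => M (p - p.@[P] *: u ^+ e))) hp.
  - by rewrite meval0 scale0r subr0; apply: (is_ideal0 idM1).
  - move=> c q q' hq hq'; rewrite mevalD mevalZ scalerDl -scalerA opprD addrACA -scalerBr.
    rewrite -[c *: _]mul_mpolyC.
    exact: (is_idealD idM1 (is_idealMl _ idM1 hq) hq').
  move=> m <-; move: {2}(mdeg m) (erefl (mdeg m)) => f; elim: f m => [|f IH] m.
    move/eqP; rewrite mdeg_eq0 => /eqP ->; rewrite mpolyX0 meval1 scale1r mdeg0 expr0 subrr.
    exact: (is_ideal0 idM1).
  move/mdegS_split=> [k [m' [-> /IH h]]].
  rewrite mpolyXD mevalM mevalXU mdegD mdeg1 exprS.
  rewrite (_ : _ - _ = 'X_[m'] * y k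
      + ((P k)%:MP * u) * ('X_[m'] - ('X_[m']).@[P] *: u ^+ mdeg m')).
    apply: (is_idealD idM1); apply: (is_idealMl _ idM1) => //; exact: My.
  by rewrite /y -/u -!mul_mpolyC mpolyCM; ring.
apply: (homog_ideal_gen (G := fun x => exists k, x = y k) (d := 1%N) (e := e.-1) (T := Q)) (Mp) _.
- by move=> _ [k ->]; rewrite rpredB ?rpredZ // dhomogX /= mdeg1.
- exact: (is_ideal0 idQ).
- by move=> ? ?; apply: (is_idealD idQ).
- move=> _ h [k ->] hh; suff : C h by [].
  apply: (homog_rect (Q := C)) hh => [|c q q' hq hq'|m me].
  + exact: (is_ideal0 idC).
  + by rewrite -mul_mpolyC; apply: (is_idealD idC) => //; apply: (is_idealMl _ idC).
  + rewrite -mmap1_id; apply: hN; rewrite me -ltnS prednK //.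
by rewrite add1n prednK.
Qed.

(** For e = d t large, the products f0 B_i with B_i the monomials of degree e are
    congruent modulo V_P S_e to scalar multiples c_i f0^(t+1).  This is a linear
    system A B = c f0^(t+1) with A = f0 - w and w with entries in V_P.  The
    adjugate of A has entries in I^(r-1), so (det A) B_i is in
    I^(r-1) I^(t+1), while det A takes the value f0(P)^r at P. *)
Theorem local_conductor (I : S -> Prop) : is_ideal I -> ideal_le V I ->
  exists N, forall t, (N <= d * t)%N -> exists r f,
    [/\ f \is (d * r).-homog, f.@[P] != 0
      & forall g, g \is (d * t).-homog -> ideal_pow I (r + t) (f * g)].
Proof.
move=> hI VI.
have [N hN] := vanishing_forms_generated.
exists N => t Nt; set e := (d * t)%N.
pose T := 'X_{1..n < e.+1}; pose r := #|{: T}|.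
pose G (m : T) : {mpoly K[n]} := if mdeg m == e then 'X_[m] else 0.
have G_homog m : G m \is e.-homog.
  by rewrite /G; case: eqP => [me|_]; [rewrite dhomogX /= me | apply: rpred0].
have expand p : p \is (d + e).-homog -> p.@[P] = 0 ->
    exists w : T -> {mpoly K[n]}, (forall m, VP (w m)) /\ p = \sum_m w m * G m.
  move=> hp pP.
  have Np : (N <= d + e)%N by apply: leq_trans Nt _; rewrite leq_addl.
  have Qp := hN _ p Np hp pP.
  apply: (homog_ideal_gen (T := fun p => exists w : T -> {mpoly K[n]},
    (forall m, VP (w m)) /\ p = \sum_m w m * G m) _ _ _ _ Qp hp).
  - by move=> g [/V_homog].
  - exists (fun=> 0); split=> [m|]; first exact: VP0.
    by rewrite big1 // => m _; rewrite mul0r.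
  - move=> q q' [w [hw ->]] [w' [hw' ->]]; exists (fun m => w m + w' m); split.
      by move=> m; rewrite -[w m]scale1r; apply: VP_lin.
    by rewrite -big_split; apply: eq_bigr => m _; rewrite mulrDl.
  - move=> g h VPg /homog_monomialE Eh; exists (fun m : T => h@_m *: g); split.
      by move=> m; rewrite -[_ *: _]addr0; apply: VP_lin => //; exact: VP0.
    rewrite [in LHS]Eh mulr_sumr; apply: eq_bigr => m _.
    by rewrite -scalerAl -scalerAr.
pose B (j : 'I_r) := G (enum_val j).
have /fin_all_exists[c Ec] : forall i : 'I_r, exists c : K,
    exists w : 'I_r -> {mpoly K[n]}, (forall j, VP (w j)) /\
      f0 * B i = c *: f0 ^+ t.+1 + \sum_j w j * B j.
  move=> i; set c := (f0 * B i).@[P] / f0.@[P] ^+ t.+1; exists c.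
  have [||w [hw Ew]] := expand (f0 * B i - c *: f0 ^+ t.+1).
  - rewrite rpredB ?rpredZ //; first by rewrite dhomogM ?V_homog ?G_homog.
    by rewrite /e -mulnS; apply: dhomogMn; apply: V_homog.
  - by rewrite mevalB mevalZ rmorphXn divfK ?subrr // expf_neq0.
  exists (fun j => w (enum_val j)); split=> //.
  rewrite -[LHS](subrK (c *: f0 ^+ t.+1)) addrC Ew; congr (_ + _).
  by rewrite (reindex _ (onW_bij _ (enum_val_bij _))).
have /fin_all_exists2[w /= VPw Ew] : forall i : 'I_r,
    exists2 w : 'I_r -> {mpoly K[n]}, (forall j, VP (w j)) &
      f0 * B i = c i *: f0 ^+ t.+1 + \sum_j w j * B j.
  by move=> i; have [w []] := Ec i; exists w.
pose A : 'M[{mpoly K[n]}]_r := f0%:M - \matrix_(i, j) w i j.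
pose Bc : 'cV[{mpoly K[n]}]_r := \col_j B j.
have AB : A *m Bc = \col_i (c i *: f0 ^+ t.+1).
  apply/colP => i; rewrite mulmxBl mul_scalar_mx !mxE Ew.
  by under [X in _ - X]eq_bigr do rewrite !mxE; rewrite addrK.
have VA i j : V (A i j).
  rewrite !mxE addrC -scaleN1r; apply: VD; first by case: (VPw i j).
  by case: (i == j); rewrite ?mulr1n ?mulr0n.
have hA i j : A i j \is d.-homog by apply: V_homog.
exists r, (\det A); split; first exact: dhomog_det.
- rewrite -[_.@[P]]/(meval P (\det A)) -det_map_mx.
  rewrite (_ : map_mx _ A = (f0.@[P])%:M) ?det_scalar ?expf_neq0 //.
  apply/matrixP => i j; rewrite !mxE rmorphB rmorphMn /=.
  by case: (VPw i j) => _ ->; rewrite subr0.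
have detB i : ideal_pow I (r + t) (\det A * B i).
  have -> : \det A * B i = \sum_j \adj A i j * (c j *: f0 ^+ t.+1).
    have := congr1 (fun X => (\adj A *m X) i 0) AB.
    rewrite /= mulmxA mul_adj_mx mul_scalar_mx !mxE => ->.
    by apply: eq_bigr => j _; rewrite !mxE.
  apply: is_ideal_sum => [|j _]; first exact: ideal_pow_ideal.
  rewrite -scalerAr -mul_mpolyC; apply: is_idealMl; first exact: ideal_pow_ideal.
  have -> : (r + t = r.-1 + t.+1)%N.
    by rewrite -addSnnS prednK // (leq_ltn_trans _ (ltn_ord i)).
  apply: ideal_powD; last by apply: ideal_powX; apply: VI.
  rewrite mxE; apply: is_idealMl; first exact: ideal_pow_ideal.
  apply: ideal_pow_det => // k l; rewrite !mxE; apply: VI.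
  by have := VA (lift j k) (lift i l); rewrite !mxE.
move=> g /homog_monomialE ->; rewrite mulr_sumr.
apply: is_ideal_sum => [|m _]; first exact: ideal_pow_ideal.
rewrite -scalerAr -mul_mpolyC; apply: is_idealMl; first exact: ideal_pow_ideal.
by have := detB (enum_rank m); rewrite /B enum_rankK.
Qed.

End Local.

(** * Descent along a finite extension *)

Section Descent.
Variables (K L : fieldType) (i : {rmorphism K -> L}) (n : nat).
Variables (T : finType) (e : T -> L) (c : T -> {additive L -> K}).
Hypotheses (cZ : forall k a x, c k (i a * x) = a * c k x)
  (cE : forall x, x = \sum_k i (c k x) * e k).
Local Notation SK := {mpoly K[n]}.
Local Notation SL := {mpoly L[n]}.

Definition coordinate k (q : SL) : SK := map_mpoly (c k) q.

(** The ideal I S_L, described by coordinates: it is the preimage of I under all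
    the coordinate functions. *)
Definition extended_ideal (I : SK -> Prop) (q : SL) : Prop :=
  forall k, I (coordinate k q).

Lemma coordinateM k (p : SK) q : coordinate k (map_mpoly i p * q) = p * coordinate k q.
Proof.
apply/mpolyP => m; rewrite mcoeff_map_mpoly !mcoeffM raddf_sum.
by apply: eq_bigr => j _; rewrite !mcoeff_map_mpoly cZ.
Qed.

Lemma coordinateE (q : SL) : q = \sum_k map_mpoly i (coordinate k q) * (e k)%:MP.
Proof.
apply/mpolyP => m; rewrite raddf_sum /= [LHS]cE.
by apply: eq_bigr => k _; rewrite [in RHS]mulrC mcoeffCM !mcoeff_map_mpoly mulrC.
Qed.

Lemma coordinate_sum k (J : Type) (r : seq J) (F : J -> SL) :
  coordinate k (\sum_(j <- r) F j) = \sum_(j <- r) coordinate k (F j).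
Proof. exact: raddf_sum. Qed.

Lemma extended_ideal_ideal I : is_ideal I -> is_ideal (extended_ideal I).
Proof.
move=> hI; split=> [k|p q hp hq k|a q hq k].
- have -> : coordinate k 0 = 0 by exact: raddf0.
  exact: is_ideal0.
- have -> : coordinate k (p + q) = coordinate k p + coordinate k q by exact: raddfD.
  exact: is_idealD.
rewrite mulrC [q]coordinateE mulr_suml coordinate_sum.
apply: is_ideal_sum => // l _; rewrite -mulrA coordinateM.
exact: is_idealMr.
Qed.

Lemma extended_idealM I t p q :
  extended_ideal I p -> extended_ideal (ideal_pow I t) q ->
  extended_ideal (ideal_pow I t.+1) (p * q).
Proof.
move=> hp hq k; rewrite [p]coordinateE mulr_suml coordinate_sum.
apply: is_ideal_sum => [|l _]; first exact: ideal_pow_ideal.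
rewrite -mulrA coordinateM; apply: ideal_powS; first exact: hp.
by apply: (is_idealMl _ (extended_ideal_ideal (ideal_pow_ideal I t))).
Qed.

Lemma extended_ideal_pow I t :
  ideal_le (ideal_pow (extended_ideal I) t) (extended_ideal (ideal_pow I t)).
Proof.
elim: t => [|t IH] //; apply: ideal_powS_le => [|p q hp /IH hq].
  exact/extended_ideal_ideal/ideal_pow_ideal.
exact: extended_idealM.
Qed.

Lemma map_extended_ideal I p : is_ideal I -> I p -> extended_ideal I (map_mpoly i p).
Proof. by move=> hI Ip k; rewrite -[map_mpoly i p]mulr1 coordinateM; apply: is_idealMr. Qed.

Lemma dhomog_map (F F' : fieldType) (h : {additive F -> F'}) d (p : {mpoly F[n]}) :
  p \is d.-homog -> map_mpoly h p \is d.-homog.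
Proof.
move=> hp; apply/dhomogP => m; rewrite mcoeff_msupp mcoeff_map_mpoly => pm.
apply/eqP; apply: contraNT pm => md.
by rewrite (dhomog_nemf_coeff hp md) raddf0.
Qed.

End Descent.

(** * Powers of the ideal *)

Section Powers.
Variables (K : fieldType) (n d' : nat).
Local Notation S := {mpoly K[n]}.
Local Notation d := d'.+1.
Variable I : S -> Prop.
Hypotheses (hI : is_ideal I) (hrad : forall k, radical I 'X_k)
  (hgen : ideal_le I (ideal_gen (fun p => I p /\ p \is d.-homog)))
  (hsep : separates_on_lines (fun p => I p /\ p \is d.-homog)).

Definition multiplies_into_pow s (f : S) : Prop :=
  forall h, ideal_pow I s (pihomog mdeg (d * s) (f * h)).

Lemma multiplies_into_pow_ideal s : is_ideal (multiplies_into_pow s).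
Proof.
have hIs := ideal_pow_ideal I s.
split=> [h|f g hf hg h|a f hf h].
- by rewrite mul0r pihomog0; apply: is_ideal0.
- by rewrite mulrDl pihomogD; apply: is_idealD.
- by rewrite [a * f]mulrC -mulrA; apply: hf.
Qed.

(** Taking components of degree d s makes this an ideal condition on arbitrary
    polynomials; for a form f it says that f multiplies all forms of degree
    d s - deg f into I^s. *)
Definition eventually_multiplies f : Prop :=
  exists s0, forall s, (s0 <= s)%N -> multiplies_into_pow s f.

Lemma eventually_multiplies_ideal : is_ideal eventually_multiplies.
Proof.
split=> [|f g [s hf] [s' hg]|a f [s hf]].
- by exists 0%N => s _; apply: (is_ideal0 (multiplies_into_pow_ideal s)).
- exists (maxn s s') => t; rewrite geq_max => /andP[st s't].
  by apply: (is_idealD (multiplies_into_pow_ideal t)); [apply: hf | apply: hg].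
- exists s => t st; apply: (is_idealMl _ (multiplies_into_pow_ideal t)).
  exact: hf.
Qed.

Lemma large_degree_mem : exists N, forall e p, (N < e)%N -> p \is e.-homog -> I p.
Proof.
have [N hN] := monomial_in_radical hI hrad; exists N => e p Ne.
apply: (homog_rect (Q := I)) => [|c q q' hq hq'|m me]; first exact: is_ideal0.
  by rewrite -mul_mpolyC; apply: is_idealD => //; apply: is_idealMl.
by rewrite -mmap1_id; apply: hN; rewrite me.
Qed.

(** One degree t suffices: above a certain degree every form is a combination of
    V, so a form of degree d (t + 1) is a sum of products of V with forms of
    degree d t, and each step contributes one more factor in I. *)
Lemma eventually_multipliesP : exists N, forall r t f, (N <= d * t)%N ->
  f \is (d * r).-homog ->
  (forall g, g \is (d * t).-homog -> ideal_pow I (r + t) (f * g)) ->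
  eventually_multiplies f.
Proof.
have [N hN] := large_degree_mem; exists N => r t f Nt hf hft.
have step j g : g \is (d * (t + j)).-homog -> ideal_pow I (r + t + j) (f * g).
  elim: j g => [|j IH] g; first by rewrite !addn0; apply: hft.
  rewrite !addnS mulnS => hg.
  have Ig : I g.
    apply: hN hg; rewrite addSn ltnS; apply: leq_trans Nt _.
    by rewrite mulnDr addnA [(d' + _)%N]addnC -addnA leq_addr.
  have idP := ideal_pow_ideal I (r + t + j).+1.
  apply: (homog_ideal_gen (T := fun q => ideal_pow I (r + t + j).+1 (f * q)) _ _ _ _ (hgen Ig) hg).
  - by move=> v [].
  - rewrite mulr0; exact: (is_ideal0 idP).
  - by move=> q q' hq hq'; rewrite mulrDr; apply: (is_idealD idP).
  - move=> v h [Iv _] /IH hh; rewrite mulrCA; exact: ideal_powS.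
exists (r + t)%N => s /subnKC <- h; rewrite (pihomog_homogM _ _ hf).
rewrite leq_mul2l -addnA leq_addr orbT -mulnBr addKn addnA.
by apply: step; apply: pihomogP.
Qed.

(** Otherwise the Nullstellensatz gives a common zero xi of all these f with
    xi_k <> 0.  Normalized to xi_k = 1, it is a point P over a finite extension L
    to which [local_conductor] applies, for the extension of I to L.  One of the
    coordinates over K of the resulting f is nonzero at P, and it still
    multiplies forms over K into the power of I. *)
Lemma eventually_multiplies_radical k : radical eventually_multiplies 'X_k.
Proof.
apply: contrapT => /forallNP hk.
have [L [i [xi [iF xi0 xik]]]] := nullstellensatz eventually_multiplies_ideal hk.
rewrite mmapX mmap1U in xik.
have [T [e [c [cZ cE]]]] := iF.
pose P l := (xi k)^-1 * xi l.
have Pk : P k = 1 by rewrite /P mulVf.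
pose IL : {mpoly L[n]} -> Prop := extended_ideal c I.
have hIL : is_ideal IL by exact: extended_ideal_ideal.
pose VL q := IL q /\ q \is d.-homog.
have VLmap v : I v /\ v \is d.-homog -> VL (map_mpoly i v).
  move=> [Iv hv]; split; last exact: dhomog_map.
  exact: map_extended_ideal.
have [v [Vv vP]] : exists v, (I v /\ v \is d.-homog) /\ mmap i P v != 0.
  apply: contrapT => hv.
  have I0 : ideal_le I (fun p => mmap i P p = 0).
    move=> p /hgen; move: p; apply: ideal_gen_le => [|p Vp].
      split=> [|p q p0 q0|a p p0]; first exact: rmorph0.
        by rewrite rmorphD /= p0 q0 addr0.
      by rewrite rmorphM /= p0 mulr0.
    by apply/eqP/negPn/negP => hp; apply: hv; exists p.
  have [N /I0] := hrad k; rewrite rmorphXn /= mmapX mmap1U Pk expr1n => /eqP.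
  by rewrite oner_eq0.
have [N hN] := eventually_multipliesP.
have VLh q : VL q -> q \is d.-homog by case.
have VL0 : VL 0 by split; [apply: (is_ideal0 hIL) | apply: rpred0].
have VLD a q q' : VL q -> VL q' -> VL (a *: q + q').
  move=> [hq hq_d] [hq' hq'_d]; split; last by rewrite rpredD ?rpredZ.
  by rewrite -mul_mpolyC; apply: (is_idealD hIL) => //; apply: (is_idealMl _ hIL).
have VLsep := separates_on_lines_map iF VLmap hsep.
rewrite -mmap_meval in vP.
have VLI : ideal_le VL IL by move=> q [].
have [M hM] := local_conductor VLh VL0 VLD VLsep Pk (VLmap _ Vv) vP hIL VLI.
have [|r [f [hf fP hft]]] := hM (N + M)%N.
  by rewrite mulSn -addnA addnCA leq_addr.
have [l fl] : exists l, (map_mpoly i (coordinate c l f)).@[P] != 0.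
  apply: contrapT => hl; case/eqP: fP.
  rewrite [f](coordinateE cE) rmorph_sum big1 //= => l _; rewrite rmorphM /=.
  have [->|nl] := eqVneq (map_mpoly i (coordinate c l f)).@[P] 0; first by rewrite mul0r.
  by case: hl; exists l.
have hfl : coordinate c l f \is (d * r).-homog by exact: dhomog_map.
have : eventually_multiplies (coordinate c l f).
  apply: (hN r (N + M)%N) => //; first by rewrite mulSn -addnA leq_addr.
  move=> g hg; rewrite mulrC -(coordinateM cZ) mulrC.
  by apply: (extended_ideal_pow cZ cE); apply: hft; apply: dhomog_map.
move=> /xi0; rewrite -mmap_meval => fxi; case/eqP: fl.
apply: (mulfI (expf_neq0 (d * r) xik)); rewrite mulr0 -fxi.
rewrite -(meval_homog_scale _ _ (dhomog_map i hfl)).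
by apply: meval_eq => q; rewrite /P mulVKf.
Qed.

Theorem maxid_pow_sub_ideal_pow : exists t0, forall t, (t0 <= t)%N ->
  ideal_le (ideal_pow maxid (d * t)) (ideal_pow I t).
Proof.
have /fin_all_exists[N hN] := eventually_multiplies_radical.
have /fin_all_exists[s hs] := hN.
exists (\sum_k s k + (\sum_k N k).+1)%N => t ht.
apply: maxid_pow_le => [|m mt]; first exact: ideal_pow_ideal.
have Jt := multiplies_into_pow_ideal t.
have : multiplies_into_pow t (mmap1 (fun k => 'X_k) m).
  apply: (monomial_in_ideal (N := N) Jt) => [k|].
    apply: hs; apply: leq_trans ht; rewrite (bigD1 k) //= -!addnA; exact: leq_addr.
  by rewrite mt mulSn; apply: leq_trans (leq_addr _ _); apply: leq_trans ht; apply: leq_addl.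
move/(_ 1); rewrite mulr1 mmap1_id pihomog_dE //.
by rewrite dhomogX /= mt.
Qed.

End Powers.

(** An ideal generated by constants is 0 or S; it contains a power of a variable
    but not 1. *)
Lemma generator_degree_gt0 (K : fieldType) n d (I : {mpoly K[n]} -> Prop) : (0 < n)%N ->
  is_ideal I -> ~ I 1 -> (forall k, radical I 'X_k) -> generated_in_degree d I ->
  (0 < d)%N.
Proof.
move=> n0 hI I1 hrad hgen; rewrite lt0n; apply/eqP => d0; subst d.
have I0 : ideal_le I (fun p => p = 0).
  move=> p /hgen; move: p; apply: ideal_gen_le => [|p [Ip hp]].
    by split=> [|x y -> ->|a x ->] //; rewrite ?addr0 ?mulr0.
  have pC : p = (p@_0)%:MP.
    apply/mpolyP => m; rewrite mcoeffC; case: (eqVneq 0%MM m) => [<-|nm].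
      by rewrite mulr1.
    by rewrite mulr0 (dhomog_nemf_coeff hp) //= mdeg_eq0 eq_sym.
  apply/eqP; apply: contraT => p0; case: I1.
  have c0 : p@_0 != 0 by apply: contra p0 => /eqP h; rewrite pC h.
  rewrite -[1]mpolyC1 -(mulVf c0) mpolyCM -pC; exact: is_idealMl.
have [N /I0] := hrad (Ordinal n0).
rewrite mpolyXn => /(congr1 (mcoeff (U_(Ordinal n0) *+ N))); rewrite mcoeffX eqxx mcoeff0.
by move/eqP; rewrite oner_eq0.
Qed.

Theorem theorem7p1 (K : fieldType) (n : nat) (hn : (0 < n)%N) (d : nat)
    (I : {mpoly K[n]} -> Prop)
    (hI : is_ideal I)
    (hhom : homogeneous_ideal I)
    (hprim : maxid_primary I)
    (hgen : generated_in_degree d I)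
    (hcase :
      linearly_presented d I \/
      (GRing.closed_field_axiom K /\
       forall z : 'I_(n - 2) -> {mpoly K[n]},
         independent_linear_forms z ->
         ideal_le (ideal_pow maxid d)
           (ideal_add I (ideal_gen (fun p => exists j, p = z j))))) :
  exists t0 : nat, forall t : nat, (t0 <= t)%N ->
    ideal_eq (ideal_pow I t) (ideal_pow maxid (d * t)).
Proof.
have [[_ I1 _] hradI] := hprim.
have hrad k : radical I ('X_k : {mpoly K[n]}) by move: (hradI 'X_k) => [_]; apply; exact: maxidX.
have d0 := generator_degree_gt0 hn hI I1 hrad hgen.
have sep : separates_on_lines (fun p => I p /\ p \is d.-homog).
  case: hcase => [hlin|[hK hz]]; first exact: linearly_presented_separates hlin.
  exact: closed_separates hz.
have sub t := ideal_pow_maxid_le (t := t) (generated_in_degree_le hgen).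
case: d d0 hgen sep sub {hcase} => // d' _ hgen sep sub.
have [|t0 ht0] := @maxid_pow_sub_ideal_pow K n d' I hI hrad _ sep.
  by move=> p /hgen.
by exists t0 => t /ht0 h p; split; [apply: sub | apply: h].
Qed.
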